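(* For every $F\in L^2(E_A)$, $$F=\mathbb{E}[F\mid Z]+\sum_{n=1}^{+\infty}\pi_n(F),$$ where $(\pi_n)_{n\in\mathbb{N}}$ is a sequence of orthogonal projectors on $L^2(E_A)$.
   Context: Setting. $A$ is an at most countable set, $E_0$ and $(E_a)_{a\in A}$ are Polish spaces and $E_A=\prod_{a\in A}E_a$. On a probability space, $Z$ is an $E_0$-valued random variable and $X=(X_a)_{a\in A}$ is a family of random variables, $X_a$ being $E_a$-valued, which is conditionally independent given $Z$: for each $a$, the conditional law of $X_a$ given $\sigma((X_b)_{b\ne a},Z)$ equals its conditional law given $\sigma(Z)$. For $B\subset A$, $X_B=(X_b)_{b\in B}$, $X^{B}=(X_b)_{b\in A\setminus B}$, $\mathcal{G}^B=\sigma(X^B)\vee\sigma(Z)$ and $\mathcal{G}^a=\mathcal{G}^{\{a\}}$. $L^2(E_A)$ is the space of real square-integrable functionals of $X$; functionals are allowed to depend measurably on $Z$ as well. The gradient is $D_aF=F-\mathbb{E}[F\mid\mathcal{G}^a]$, $a\in A$. The operators $\pi_n$: let $(A_m)_{m}$ be an increasing sequence of finite subsets of $A$ with union $A$, and for $n\le |A_m|$ let $$\pi_n^m=\sum_{J\subset A_m,\ |J|=n}\Big(\prod_{b\in J}D_b\Big)\Big(\prod_{c\in A_m\setminus J}\mathbb{E}[\,\cdot\mid\mathcal{G}^c]\Big)$$ (products are compositions of operators), with $\pi_n^m=0$ for $n>|A_m|$. For $F\in L^2(E_A)$, $\pi_n(F)$ is the limit of $\pi_n^m(F)$ as $m\to\infty$.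 *)

(* Defs.v *)
From HB Require Import structures.
From mathcomp Require Import all_boot all_order all_algebra finmap.
From mathcomp Require Import all_classical all_reals all_analysis.

Set Implicit Arguments.
Unset Strict Implicit.
Unset Printing Implicit Defensive.

Import Order.TTheory GRing.Theory Num.Theory.
Import numFieldNormedType.Exports.

Local Open Scope classical_set_scope.
Local Open Scope ring_scope.

Definition polish (R : realType) (T : topologicalType) : Prop :=
  exists (M : metricType R) (f : T -> M) (g : M -> T),
    [/\ cancel f g /\ cancel g f,
        continuous f /\ continuous g,
        (forall F : set_system M, ProperFilter F -> cauchy F ->
           exists x : M, F --> x) &
        exists2 D : set M, countable D & dense D].

(* The points carried by the spaces are only what measurableType requires;
   a space in which a random variable takes its values is nonempty. *)
Notation borel T := (g_sigma_algebraType (@open T)).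

Section L2_on_probability_space.
Context d (Omega : measurableType d) (R : realType) (P : probability Omega R).

Definition is_condexp (G : set (set Omega)) (F C : Omega -> R) : Prop :=
  [/\ (forall U : set R, measurable U -> G (C @^-1` U)),
      P.-integrable setT (EFin \o C) &
      forall B, G B ->
        (\int[P]_(w in B) (C w)%:E = \int[P]_(w in B) (F w)%:E)%E].

(* A version of E[F | G]; zero when F has no conditional expectation. *)
Definition condexp (G : set (set Omega)) (F : Omega -> R) : Omega -> R :=
  xget (cst 0) [set C | is_condexp G F C].

(* The conditional law of Y given G, as the set function U |-> P(Y \in U | G).
   Borel sigma-algebras of Polish spaces being countably generated, two
   conditional laws agree a.s. iff they agree a.s. on each Borel set U. *)
Definition cond_law (G : set (set Omega)) d' (T : measurableType d')
    (Y : Omega -> T) (U : set T) : Omega -> R :=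
  condexp G (\1_(Y @^-1` U)).

Definition L2_cvg (u : nat -> Omega -> R) (F : Omega -> R) : Prop :=
  (fun m => 'N[P]_(2%:E)[EFin \o (u m \- F)%R]%E) @ \oo --> 0%E.

(* H is a linear space of square integrable functions; operators on the
   corresponding space of a.s. classes are given on representatives. *)
Definition orthogonal_projector (H : set (Omega -> R))
    (T : (Omega -> R) -> Omega -> R) : Prop :=
  [/\ (forall F, H F -> H (T F)),
      (forall F G, H F -> H G -> F = G %[ae P] -> T F = T G %[ae P]),
      (forall (c : R) F G, H F -> H G ->
         T (fun w => c * F w + G w) = (fun w => c * T F w + T G w) %[ae P]),
      (forall F, H F -> T (T F) = T F %[ae P]) &
      (forall F G, H F -> H G -> ('E_P[(T F \* G)%R] = 'E_P[(F \* T G)%R])%E)].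

Definition orthogonal_ranges (H : set (Omega -> R))
    (S T : (Omega -> R) -> Omega -> R) : Prop :=
  forall F G, H F -> H G -> ('E_P[(S F \* T G)%R] = 0)%E.

End L2_on_probability_space.

Section functionals.
Context d (Omega : measurableType d) (R : realType) (P : probability Omega R).
Context (A : countType) (E0 : ptopologicalType) (E : A -> ptopologicalType).
Context (Z : {RV P >-> borel E0}) (X : forall a, {RV P >-> borel (E a)}).

Definition sigmaZ : set (set Omega) :=
  preimage_set_system setT Z measurable.

(* sigma(X_b, b \notin B) \/ sigma(Z) *)
Definition sigmaG (B : set A) : set (set Omega) :=
  <<s (\bigcup_(b in ~` B) preimage_set_system setT (X b) measurable)
      `|` sigmaZ >>.

Definition cond_independent : Prop :=
  forall (a : A) (U : set (borel (E a))), measurable U ->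
    cond_law P (sigmaG [set a]) (X a) U = cond_law P sigmaZ (X a) U %[ae P].

Definition E_A : pointedType := forall a, borel (E a).

Definition E_A_cylinders : set (set E_A) :=
  \bigcup_(a in [set: A]) preimage_set_system setT (fun x : E_A => x a)
     measurable.

(* The square integrable functionals f(X, Z), with f measurable for the product
   sigma-algebra. *)
Definition L2_functional : set (Omega -> R) :=
  [set F | F \in Lfun P 2%:E /\
     exists2 f : g_sigma_algebraType E_A_cylinders * borel E0 -> R,
       measurable_fun setT f &
       F = fun w => f ((fun a => X a w), Z w)].

Definition condexpG (a : A) (F : Omega -> R) : Omega -> R :=
  condexp P (sigmaG [set a]) F.

Definition gradient (a : A) (F : Omega -> R) : Omega -> R :=
  F \- condexpG a F.

(* The products are compositions in the order in which J and S `\` J are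
   enumerated; the factors commute almost surely under conditional
   independence. *)
Definition pi_fin (S : {fset A}) (n : nat) (F : Omega -> R) : Omega -> R :=
  fun w => \sum_(J <- fpowerset S | #|` J| == n)
    ((\big[comp/id]_(b <- J) gradient b)
       ((\big[comp/id]_(c <- (S `\` J)%fset) condexpG c) F)) w.

(* The L^2 limit of pi_n^m(F), zero if there is none. *)
Definition chaos_proj (Am : nat -> {fset A}) (n : nat) (F : Omega -> R) :
    Omega -> R :=
  xget (cst 0) [set G | L2_functional G /\
                        L2_cvg P (fun m => pi_fin (Am m) n F) G].

End functionals.

(* Main.v *)
Require Import Defs.
From HB Require Import structures.
From mathcomp Require Import all_boot all_order all_algebra finmap.
From mathcomp Require Import all_classical all_reals all_analysis.
From mathcomp Require Import measurable_realfun ring lra.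

Set Implicit Arguments.
Unset Strict Implicit.
Unset Printing Implicit Defensive.

Import Order.TTheory GRing.Theory Num.Theory.
Import numFieldNormedType.Exports.

Local Open Scope classical_set_scope.
Local Open Scope ring_scope.

(** Square integrable functions modulo almost sure equality form a Hilbert
    space [L2class P], on which E[. | G] is the orthogonal projection onto the
    classes having a G-measurable representative ([condexpP]). The theorem is
    then a statement about a commuting family of projections.

    Write P_a for E[. | G^a]. Conditional independence enters once, in
    [projG_forgets]: P_a maps a function of Z and of the X_b, b outside C, to a
    function of Z and of the X_b, b outside C and b <> a. Indeed on a product
    1_U(X_a) 1_W, with W not involving X_a, conditioning on G^a replaces
    1_U(X_a) by P(X_a in U | Z), and such products generate. Hence P_a P_b and
    P_b P_a are both the projection onto the functions that involve neither
    X_a nor X_b, so the P_a commute ([projG_comm]).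

    Let S be finite. Splitting u = P_a u + D_a u for one a in S after the other
    writes every vector as a sum of joint eigenvectors: vectors v with a set
    J included in S such that P_a v = 0 for a in J and P_a v = v for the other
    a in S ([sum_of_eigens]). Eigenvectors with different J are orthogonal
    because the P_a are self-adjoint, and the term of index J in pi_n^m fixes
    the eigenvectors of type J and kills the others. So pi_n^m keeps exactly
    the eigenvectors with |J| = n ([chaos_eigen]). All finite-level identities
    (idempotence, self-adjointness, orthogonality of ranges for different n,
    sum over n equal to the identity) are read off on eigenvectors.

    It remains to let m tend to infinity. A functional of Z and of the X_b,
    b in A_k, is fixed by P_a for a outside A_k; its images under pi_n^m do not
    change for m >= k ([chaos_stationary]), its pi_0 is E[. | Z] and only
    finitely many pi_n act on it. These functionals are dense in the functions
    of X and Z ([L2_of_dense], a form of Dynkin's theorem). All operators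
    involved being contractions, the set of vectors for which the required
    convergence holds is closed ([closed_convergent], [closed_vanish]), and
    completeness of [L2class P] provides the limits. Orthogonality and
    idempotence pass to the limit by continuity of the inner product. Finally
    the Doob-Dynkin lemma identifies the functionals f(X, Z) with the functions
    measurable for the sigma-algebra generated by X and Z
    ([L2_functionalP]). *)

(** * Inner product spaces *)

Record inner_product (R : realType) (V : lmodType R) := InnerProduct {
  ip :> V -> V -> R;
  ipC : forall u v, ip u v = ip v u;
  ipPl : forall c u v w, ip (c *: u + v) w = c * ip u w + ip v w;
  ip_ge0 : forall u, 0 <= ip u u;
  ip_eq0 : forall u, ip u u = 0 -> u = 0 }.
Arguments ip_eq0 {R V} _ [u] _.

Section inner_product_theory.
Context {R : realType} {V : lmodType R} (ip : inner_product V).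
Implicit Types (u v w : V) (K : set V).

Definition sqn u := ip u u.

(** Convergence is expressed with the square of the norm, so that no square
    root appears. *)
Definition norm_cvg (s : nat -> V) (l : V) :=
  (fun n => sqn (s n - l)) @ \oo --> 0.

Definition norm_cauchy (s : nat -> V) :=
  forall e : R, 0 < e -> exists N, forall m n, (N <= m)%N -> (N <= n)%N ->
    sqn (s m - s n) < e.

Definition norm_complete := forall s, norm_cauchy s -> exists l, norm_cvg s l.

Definition linspace K := K 0 /\ forall c u v, K u -> K v -> K (c *: u + v).

Definition norm_closed K :=
  forall s l, (forall n, K (s n)) -> norm_cvg s l -> K l.

Definition is_orthoproj K u p := K p /\ forall k, K k -> ip (u - p) k = 0.

Lemma ipDl u v w : ip (u + v) w = ip u w + ip v w.
Proof. by have := ipPl ip 1 u v w; rewrite scale1r mul1r. Qed.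

Lemma ip0l w : ip 0 w = 0.
Proof. by have := ipDl 0 0 w; rewrite addr0; lra. Qed.

Lemma ipZl c u w : ip (c *: u) w = c * ip u w.
Proof. by have := ipPl ip c u 0 w; rewrite ip0l !addr0. Qed.

Lemma ipNl u w : ip (- u) w = - ip u w.
Proof. by rewrite -scaleN1r ipZl mulN1r. Qed.

Lemma ipBl u v w : ip (u - v) w = ip u w - ip v w.
Proof. by rewrite ipDl ipNl. Qed.

Lemma ipDr u v w : ip w (u + v) = ip w u + ip w v.
Proof. by rewrite !(ipC ip w) ipDl. Qed.

Lemma ip0r w : ip w 0 = 0. Proof. by rewrite ipC ip0l. Qed.

Lemma ipZr c u w : ip w (c *: u) = c * ip w u.
Proof. by rewrite !(ipC ip w) ipZl. Qed.

Lemma ipBr u v w : ip w (u - v) = ip w u - ip w v.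
Proof. by rewrite !(ipC ip w) ipBl. Qed.

Lemma sqnD u v : sqn (u + v) = sqn u + 2 * ip u v + sqn v.
Proof. by rewrite /sqn ipDl !ipDr (ipC ip v u); ring. Qed.

Lemma sqnB u v : sqn (u - v) = sqn u - 2 * ip u v + sqn v.
Proof. by rewrite /sqn ipBl !ipBr (ipC ip v u); ring. Qed.

Lemma sqnZ c u : sqn (c *: u) = c ^+ 2 * sqn u.
Proof. by rewrite /sqn ipZl ipZr; ring. Qed.

Lemma sqnN u : sqn (- u) = sqn u.
Proof. by rewrite -scaleN1r sqnZ sqrrN expr1n mul1r. Qed.

Lemma sqn0 : sqn 0 = 0. Proof. exact: ip0l. Qed.

Lemma sqnC u v : sqn (u - v) = sqn (v - u).
Proof. by rewrite !sqnB (ipC ip v u); ring. Qed.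

Lemma sqnD_le u v : sqn (u + v) <= 2 * sqn u + 2 * sqn v.
Proof. by have := ip_ge0 ip (u - v); rewrite -/(sqn _) sqnB sqnD; lra. Qed.

Lemma sqnB_le u v w : sqn (u - w) <= 2 * sqn (u - v) + 2 * sqn (v - w).
Proof. by rewrite -[u in leLHS](subrK v) -addrA sqnD_le. Qed.

(** Expand [0 <= |u - t v|^2] at the minimizing [t]. *)
Lemma cauchy_schwarz u v : (ip u v) ^+ 2 <= sqn u * sqn v.
Proof.
have [v0|v0] := eqVneq (sqn v) 0.
  by rewrite (ip_eq0 ip v0) ip0r sqn0 mulr0 expr0n.
have v_gt0 : 0 < sqn v by rewrite lt_def v0 (ip_ge0 ip).
have := ip_ge0 ip (u - (ip u v / sqn v) *: v).
rewrite -/(sqn _) sqnB sqnZ ipZr -(pmulr_lge0 _ v_gt0).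
suff -> : (sqn u - 2 * (ip u v / sqn v * ip u v)
    + (ip u v / sqn v) ^+ 2 * sqn v) * sqn v = sqn u * sqn v - (ip u v) ^+ 2.
  by rewrite subr_ge0.
by field.
Qed.

Lemma norm_cvgP s l : norm_cvg s l <->
  forall e : R, 0 < e -> exists N, forall n, (N <= n)%N -> sqn (s n - l) < e.
Proof.
split=> [sl e e0|sl].
  have /cvgrPdist_lt /(_ e e0) [N _ sN] := sl.
  exists N => n /sN /=; rewrite sub0r normrN ger0_norm//.
  exact: (ip_ge0 ip).
apply/cvgrPdist_lt => e /sl[N sN]; exists N => // n /= /sN.
by rewrite sub0r normrN ger0_norm//; exact: (ip_ge0 ip).
Qed.

Lemma norm_cvg_cst u : norm_cvg (fun=> u) u.
Proof. by rewrite /norm_cvg subrr sqn0; exact: cvg_cst. Qed.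

Lemma norm_cvg_eventually s u N :
  (forall n, (N <= n)%N -> s n = u) -> norm_cvg s u.
Proof.
by move=> su; apply/norm_cvgP => e e0; exists N => n /su ->; rewrite subrr sqn0.
Qed.

Lemma norm_cvg_lin c s t l k : norm_cvg s l -> norm_cvg t k ->
  norm_cvg (fun n => c *: s n + t n) (c *: l + k).
Proof.
move=> sl tk; rewrite /norm_cvg.
apply: (@squeeze_cvgr _ _ _ _ (cst 0)
  (fun n => 2 * (c ^+ 2 * sqn (s n - l)) + 2 * sqn (t n - k))).
- apply: nearW => n; rewrite (ip_ge0 ip) /= -sqnZ.
  rewrite (_ : _ - _ = c *: (s n - l) + (t n - k)) ?sqnD_le//.
  by rewrite scalerBr opprD addrACA.
- exact: cvg_cst.
- rewrite [X in _ --> X](_ : 0 = 2 * (c ^+ 2 * 0) + 2 * 0); last by ring.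
  apply: cvgD; apply: cvgMr => //; exact: cvgMr.
Qed.

Lemma norm_cvgD s t l k : norm_cvg s l -> norm_cvg t k ->
  norm_cvg (fun n => s n + t n) (l + k).
Proof.
move=> sl tk; have := norm_cvg_lin 1 sl tk.
by under eq_fun do rewrite scale1r; rewrite scale1r.
Qed.

Lemma norm_cvgZ c s l : norm_cvg s l -> norm_cvg (fun n => c *: s n) (c *: l).
Proof.
move=> sl; have := norm_cvg_lin c sl (norm_cvg_cst 0).
by under eq_fun do rewrite addr0; rewrite addr0.
Qed.

Lemma norm_cvgB s t l k : norm_cvg s l -> norm_cvg t k ->
  norm_cvg (fun n => s n - t n) (l - k).
Proof.
move=> sl tk; rewrite -scaleN1r; under eq_fun do rewrite -scaleN1r.
by apply: norm_cvgD => //; exact: norm_cvgZ.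
Qed.

Lemma norm_cvg_unique s l k : norm_cvg s l -> norm_cvg s k -> l = k.
Proof.
move=> sl sk; apply: subr0_eq; apply: (ip_eq0 ip).
have := norm_cvgB sl sk; rewrite /norm_cvg.
under eq_fun do rewrite subrr sub0r sqnN.
by move/cvg_lim => /(_ (@Rhausdorff _)); rewrite lim_cst//; exact: Rhausdorff.
Qed.

Lemma norm_cvg_ip s l w : norm_cvg s l ->
  (fun n => ip (s n) w) @ \oo --> ip l w.
Proof.
move=> sl; apply/cvgrPdist_lt => e e0.
have d0 : 0 < e ^+ 2 / (sqn w + 1).
  by rewrite divr_gt0 ?exprn_gt0 ?ltr_wpDl ?(ip_ge0 ip).
have [N sN] := (norm_cvgP s l).1 sl _ d0.
exists N => // n /= /sN; rewrite ltr_pdivlMr ?ltr_wpDl ?(ip_ge0 ip)// => sne.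
rewrite -ipBl -ltr_sqr ?nnegrE ?(ltW e0)// real_normK ?num_real//.
apply: (le_lt_trans (cauchy_schwarz _ _)); apply: le_lt_trans sne.
by rewrite sqnC ler_wpM2l ?lerDl ?(ip_ge0 ip).
Qed.

Lemma norm_cvg_sqn s l : norm_cvg s l -> (fun n => sqn (s n)) @ \oo --> sqn l.
Proof.
move=> sl.
rewrite (_ : (fun n => _) =
  (fun n => sqn (s n - l) + 2 * ip (s n) l - sqn l)); last first.
  by apply/funext => n; rewrite sqnB; ring.
rewrite [X in _ --> X](_ : _ = 0 + 2 * ip l l - sqn l); last first.
  by rewrite /sqn; ring.
apply: cvgB; last exact: cvg_cst.
by apply: cvgD => //; apply: cvgMr => //; exact: norm_cvg_ip.
Qed.

(** By polarization, from the continuity of the square norm. *)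
Lemma norm_cvg_ip2 s t l k : norm_cvg s l -> norm_cvg t k ->
  (fun n => ip (s n) (t n)) @ \oo --> ip l k.
Proof.
have polar u v : ip u v = (sqn (u + v) - sqn u - sqn v) / 2.
  by rewrite sqnD; field.
move=> sl tk; rewrite polar; under eq_fun do rewrite polar.
apply: cvgMl => //; apply: cvgB; last exact: norm_cvg_sqn.
by apply: cvgB; apply: norm_cvg_sqn => //; exact: norm_cvgD.
Qed.

Lemma norm_cvg_cauchy s l : norm_cvg s l -> norm_cauchy s.
Proof.
move=> /norm_cvgP sl e e0; have [|N sN] := sl (e / 4).
  by rewrite divr_gt0.
exists N => m n /sN sm /sN sn.
by apply: (le_lt_trans (sqnB_le _ l _)); rewrite (sqnC l); lra.
Qed.

(** The index [j] is added to [k j] only to make the subsequence go to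
    infinity when the Cauchy ranks are bounded. *)
Lemma fast_cauchy (s : nat -> V) (e : nat -> R) : (forall j, 0 < e j) ->
  norm_cauchy s ->
  exists k : nat -> nat, forall j, (j <= k j)%N /\
    sqn (s (k j.+1) - s (k j)) < e j.
Proof.
move=> e0 sC; have /choice[N NP] j := sC (e j) (e0 j).
pose k j := (j + \max_(i < j.+1) N i)%N.
have Nk j : (N j <= k j)%N.
  by apply: leq_trans (leq_addl _ _); exact: (leq_bigmax (@ord_max j)).
have Nk1 j : (N j <= k j.+1)%N.
  apply: leq_trans (leq_addl _ _).
  exact: (leq_bigmax (widen_ord (leqnSn j.+1) (@ord_max j))).
by exists k => j; split; [exact: leq_addr|exact: NP].
Qed.

Lemma linspaceD K u v : linspace K -> K u -> K v -> K (u + v).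
Proof. by move=> [_ KP] Ku Kv; have := KP 1 _ _ Ku Kv; rewrite scale1r. Qed.

Lemma linspaceZ K c u : linspace K -> K u -> K (c *: u).
Proof. by move=> [K0 KP] Ku; have := KP c _ _ Ku K0; rewrite addr0. Qed.

Lemma linspaceB K u v : linspace K -> K u -> K v -> K (u - v).
Proof.
by move=> Ks Ku Kv; apply: linspaceD => //; rewrite -scaleN1r; exact: linspaceZ.
Qed.

(** A minimizing sequence for the distance to [K] is Cauchy by the
    parallelogram law; perturbing its limit [p] along [k] in [K] shows that
    [u - p] is orthogonal to [k]. *)
Lemma proj_exists K u : norm_complete -> linspace K -> norm_closed K ->
  exists p, is_orthoproj K u p.
Proof.
move=> cV Ks Kc; have K0 : K 0 by case: Ks.
pose D := [set sqn (u - k) | k in K].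
have Dinf : has_inf D.
  by split; [exists (sqn (u - 0)); exists 0
    |exists 0 => _ [k _ <-]; exact: ip_ge0].
pose d := inf D.
have dle k : K k -> d <= sqn (u - k).
  by move=> Kk; apply: ge_inf => //; [case: Dinf|exists k].
have /choice[s sP] n : exists k, K k /\ sqn (u - k) < d + n.+1%:R^-1.
  have n0 : 0 < n.+1%:R^-1 :> R by rewrite invr_gt0.
  by have [_ [k Kk <-]] := inf_adherent n0 Dinf; exists k.
have half m n : sqn (s m - s n) <= 2 * (m.+1%:R^-1 + n.+1%:R^-1).
  have [[Km sm] [Kn sn]] := (sP m, sP n).
  have Kh : K (2^-1 *: (s m + s n)) by apply: linspaceZ => //; exact: linspaceD.
  have := dle _ Kh.
  have -> : sqn (u - 2^-1 *: (s m + s n)) =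
      (sqn (u - s m) + sqn (u - s n)) / 2 - sqn (s m - s n) / 4.
    by rewrite !sqnB !ipZr sqnZ ipDr sqnD; field.
  move: (sqn (u - s m)) (sqn (u - s n)) (sqn (s m - s n)) sm sn => a b c.
  move: (m.+1%:R^-1) (n.+1%:R^-1) => x y; lra.
have inv_small (e : R) : 0 < e ->
    exists N, forall n, (N <= n)%N -> n.+1%:R^-1 < e.
  move=> e0; have /cvgrPdist_lt /(_ e e0) [N _ sN] := @cvg_harmonic R.
  exists N => n /sN /=; rewrite sub0r normrN ger0_norm//.
have [p sp] : exists p, norm_cvg s p.
  apply: cV => e e0; have [|N sN] := inv_small (e / 4).
    by rewrite divr_gt0.
  exists N => m n /sN + /sN; move: (half m n).
  by move: (m.+1%:R^-1) (n.+1%:R^-1) => x y; lra.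
have Kp : K p by apply: Kc sp => n; case: (sP n).
have up : sqn (u - p) <= d.
  have /norm_cvg_sqn cup := norm_cvgB (norm_cvg_cst u) sp.
  have cd : (fun n => d + n.+1%:R^-1) @ \oo --> d.
    by rewrite -[X in _ --> X]addr0; apply: cvgD;
      [exact: cvg_cst|exact: cvg_harmonic].
  by apply: (ler_cvg_to cup cd); apply: nearW => n; apply/ltW; case: (sP n).
exists p; split => // k Kk.
have [k0|k0] := eqVneq (sqn k) 0; first by rewrite (ip_eq0 ip k0) ip0r.
have k_gt0 : 0 < sqn k by rewrite lt_def k0 (ip_ge0 ip).
(* [p + c k] minimizes the distance to [u] on the line through [p] along [k]. *)
pose c := ip (u - p) k / sqn k.
have Kpc : K (p + c *: k) by apply: linspaceD => //; exact: linspaceZ.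
have := le_trans up (dle _ Kpc).
rewrite opprD addrA (sqnB (u - p)) ipZr sqnZ.
have -> : sqn (u - p) - 2 * (c * ip (u - p) k) + c ^+ 2 * sqn k =
  sqn (u - p) - (ip (u - p) k) ^+ 2 / sqn k by rewrite /c; field.
rewrite lerBrDr -lerBrDl subrr pmulr_lle0 ?invr_gt0// => h.
by apply/eqP; rewrite -sqrf_eq0 eq_le h sqr_ge0.
Qed.

Lemma proj_unique K u p q : linspace K ->
  is_orthoproj K u p -> is_orthoproj K u q -> p = q.
Proof.
move=> Ks [Kp up] [Kq uq]; apply: subr0_eq; apply: (ip_eq0 ip).
have Kpq : K (p - q) by exact: linspaceB.
by move: (up _ Kpq) (uq _ Kpq); rewrite !(ipBl _ _ (p - q)); lra.
Qed.

Lemma is_projP K c u v p q : linspace K ->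
  is_orthoproj K u p -> is_orthoproj K v q ->
  is_orthoproj K (c *: u + v) (c *: p + q).
Proof.
move=> [_ KP] [Kp up] [Kq vq]; split=> [|k Kk]; first exact: KP.
move: (up _ Kk) (vq _ Kk); rewrite !ipBl !ipDl !ipZl => uk vk.
suff -> : ip u k = ip p k by lra.
lra.
Qed.

Lemma is_proj_id K u : K u -> is_orthoproj K u u.
Proof. by move=> Ku; split=> // k _; rewrite subrr ip0l. Qed.

End inner_product_theory.

(** * Linear operators and their strong limits *)

Definition is_linear (R : realType) (V : lmodType R) (T : V -> V) :=
  forall c u v, T (c *: u + v) = c *: T u + T v.

(** The limits of the finite-level operators are controlled on a subspace only,
    hence this relative form of linearity. *)
Definition is_linear_on (R : realType) (V : lmodType R) (H : set V)
    (T : V -> V) :=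
  forall c u v, H u -> H v -> T (c *: u + v) = c *: T u + T v.

Section linear_operators.
Context {R : realType} {V : lmodType R} (ip : inner_product V).
Implicit Types (u v w : V) (K H : set V) (T : V -> V).
Local Notation sqn := (sqn ip).
Local Notation norm_cvg := (norm_cvg ip).

Lemma lin0 T : is_linear T -> T 0 = 0.
Proof.
by move=> /(_ (-1) 0 0); rewrite scaleN1r oppr0 addr0 scaleN1r addNr.
Qed.

Lemma linD T u v : is_linear T -> T (u + v) = T u + T v.
Proof. by move=> /(_ 1 u v); rewrite !scale1r. Qed.

Lemma linZ T c u : is_linear T -> T (c *: u) = c *: T u.
Proof. by move=> Tl; have := Tl c u 0; rewrite !addr0 lin0// addr0. Qed.

Lemma linB T u v : is_linear T -> T (u - v) = T u - T v.
Proof. by move=> Tl; rewrite linD// -scaleN1r linZ// scaleN1r. Qed.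

Lemma lin_id : is_linear (@id V). Proof. by []. Qed.

Lemma lin_comp S T : is_linear S -> is_linear T -> is_linear (S \o T).
Proof. by move=> Sl Tl c u v /=; rewrite Tl Sl. Qed.

Lemma lin_sum (I : Type) (r : seq I) (p : pred I) (F : I -> V -> V) :
  (forall i, is_linear (F i)) -> is_linear (fun u => \sum_(i <- r | p i) F i u).
Proof.
move=> Fl c u v; rewrite scaler_sumr -big_split/=.
by apply: eq_bigr => i _; exact: Fl.
Qed.

Lemma lin_sub S T : is_linear S -> is_linear T -> is_linear (fun u => S u - T u).
Proof. by move=> Sl Tl c u v; rewrite Sl Tl opprD addrACA scalerBr. Qed.

Lemma lin_on0 H T : linspace H -> is_linear_on H T -> T 0 = 0.
Proof.
move=> [H0 _] /(_ (-1) 0 0 H0 H0).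
by rewrite scaleN1r oppr0 addr0 scaleN1r addNr.
Qed.

Lemma lin_onB H T u v : is_linear_on H T -> H u -> H v -> T (u - v) = T u - T v.
Proof.
by move=> Tl Hu Hv; rewrite addrC -scaleN1r Tl// scaleN1r addrC.
Qed.

Section orthogonal_projection.
Context (K : set V) (T : V -> V).
Hypotheses (Ks : linspace K) (TP : forall u, is_orthoproj ip K u (T u)).

Lemma proj_lin : is_linear T.
Proof. by move=> c u v; apply: (proj_unique Ks (TP _)); exact: is_projP. Qed.

Lemma proj_fix u : K u -> T u = u.
Proof. by move=> Ku; apply: (proj_unique Ks (TP _)); exact: is_proj_id. Qed.

Lemma proj_idem u : T (T u) = T u.
Proof. by rewrite proj_fix//; case: (TP u). Qed.

Lemma proj_selfadj u v : ip (T u) v = ip u (T v).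
Proof.
have [[Tu /(_ _ (TP v).1) uv] [Tv /(_ _ (TP u).1) vu]] := (TP u, TP v).
by move: uv vu; rewrite !ipBl (ipC ip v) (ipC ip (T v)); lra.
Qed.

End orthogonal_projection.

(** An idempotent self-adjoint operator is a contraction, because
    [|u|^2 = |T u|^2 + |u - T u|^2]. *)
Lemma selfadj_idem_contraction H T u : H u -> H (T u) -> T (T u) = T u ->
  (forall v w, H v -> H w -> ip (T v) w = ip v (T w)) -> sqn (T u) <= sqn u.
Proof.
move=> Hu HTu TT Tsa; have TuTu : ip (T u) (T u) = ip u (T u) by rewrite Tsa// TT.
have := ip_ge0 ip (u - T u); rewrite -/(sqn _) sqnB -TuTu -/(sqn (T u)).
by lra.
Qed.

Lemma proj_le K T u : linspace K -> (forall v, is_orthoproj ip K v (T v)) ->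
  sqn (T u) <= sqn u.
Proof.
move=> Ks TP; apply: (@selfadj_idem_contraction setT) => //.
  exact: (proj_idem Ks TP).
by move=> v w _ _; exact: proj_selfadj TP v w.
Qed.

Lemma norm_cvg_proj K T s l : linspace K ->
  (forall v, is_orthoproj ip K v (T v)) ->
  norm_cvg s l -> norm_cvg (fun n => T (s n)) (T l).
Proof.
move=> Ks TP /norm_cvgP sl; apply/norm_cvgP => e /sl[N sN]; exists N => n /sN.
by apply: le_lt_trans; rewrite -(linB _ _ (proj_lin Ks TP)) (proj_le _ Ks TP).
Qed.

(** For a sequence of uniformly bounded operators, convergence need only be
    checked on a dense set: the sets of vectors on which the sequence converges,
    or tends to zero, are closed subspaces. *)
Section bounded_sequence.
Context (H : set V) (T : nat -> V -> V) (C : R).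
Hypotheses (Hs : linspace H) (Hc : norm_closed ip H) (C0 : 0 < C).
Hypothesis Tl : forall m, is_linear_on H (T m).
Hypothesis TC : forall m u, H u -> sqn (T m u) <= C * sqn u.

Lemma linspace_vanish : linspace [set u | H u /\ norm_cvg (T^~ u) 0].
Proof.
split; first split; first by case: Hs.
  by under eq_fun do rewrite (lin_on0 Hs)//; exact: norm_cvg_cst.
move=> c u v [Hu Tu] [Hv Tv]; split; first by case: Hs => _; exact.
under eq_fun do rewrite Tl//.
by have := norm_cvg_lin c Tu Tv; rewrite scaler0 addr0.
Qed.

Lemma closed_vanish : norm_closed ip [set u | H u /\ norm_cvg (T^~ u) 0].
Proof.
move=> s l sP sl; have Hsn n : H (s n) by case: (sP n).
have Hl := Hc Hsn sl; split => //; apply/norm_cvgP => e e0.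
have [|k /(_ _ (leqnn k)) sk] := (norm_cvgP _ _ _).1 sl (e / (4 * C)).
  by rewrite divr_gt0 ?mulr_gt0.
have [|N TN] := (norm_cvgP _ _ _).1 (sP k).2 (e / 4); first by rewrite divr_gt0.
exists N => n /TN; rewrite !subr0 => Tn.
have := TC n (linspaceB Hs Hl (Hsn k)); rewrite (lin_onB (Tl _))// sqnC in sk *.
move: sk; rewrite ltr_pdivlMr ?mulr_gt0// => sk TC'.
apply: (@le_lt_trans _ _ (2 * sqn (T n l - T n (s k)) + 2 * sqn (T n (s k)))).
  by have := sqnB_le ip (T n l) (T n (s k)) 0; rewrite !subr0.
by move: (sqn _) (sqn _) (sqn _) sk TC' Tn => x y z; lra.
Qed.

Lemma linspace_convergent :
  linspace [set u | H u /\ exists l, norm_cvg (T^~ u) l].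
Proof.
split; first split; first by case: Hs.
  by exists 0; under eq_fun do rewrite (lin_on0 Hs)//; exact: norm_cvg_cst.
move=> c u v [Hu [k Tu]] [Hv [l Tv]]; split; first by case: Hs => _; exact.
exists (c *: k + l).
by under eq_fun do rewrite Tl//; exact: norm_cvg_lin.
Qed.

Lemma closed_convergent : norm_complete ip ->
  norm_closed ip [set u | H u /\ exists l, norm_cvg (T^~ u) l].
Proof.
move=> cV s l sP sl; have Hsn n : H (s n) by case: (sP n).
have Hl := Hc Hsn sl; split => //; apply: cV => e e0.
have [|k /(_ _ (leqnn k)) sk] := (norm_cvgP _ _ _).1 sl (e / (12 * C)).
  by rewrite divr_gt0 ?mulr_gt0.
have [t /norm_cvg_cauchy/(_ (e / 12))[|N TN]] := (sP k).2.
  by rewrite divr_gt0.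
exists N => m n Nm Nn; have := TN _ _ Nm Nn.
have := TC m (linspaceB Hs Hl (Hsn k)).
have := TC n (linspaceB Hs Hl (Hsn k)); rewrite !(lin_onB (Tl _))// sqnC in sk *.
move: sk; rewrite ltr_pdivlMr ?mulr_gt0// => sk TCn TCm Tmn.
have h1 := sqnB_le ip (T m l) (T m (s k)) (T n l).
have h2 := sqnB_le ip (T m (s k)) (T n (s k)) (T n l).
move: h1 h2 TCn TCm Tmn; rewrite (sqnC _ (T n (s k))).
move: sk; move: (sqn _) (sqn _) (sqn _) (sqn _) (sqn _) (sqn _) => a b c d f g.
lra.
Qed.

End bounded_sequence.

Lemma ip_suml (I : Type) (r : seq I) (p : pred I) (F : I -> V) w :
  ip (\sum_(i <- r | p i) F i) w = \sum_(i <- r | p i) ip (F i) w.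
Proof. by apply: (big_morph (ip^~ w)) => [u v|]; [exact: ipDl|exact: ip0l]. Qed.

Lemma ip_sumr (I : Type) (r : seq I) (p : pred I) (F : I -> V) w :
  ip w (\sum_(i <- r | p i) F i) = \sum_(i <- r | p i) ip w (F i).
Proof. by rewrite ipC ip_suml; apply: eq_bigr => i _; rewrite ipC. Qed.

End linear_operators.

(** * Chaos decomposition along a family of commuting projections *)

Section sum_of.
Context {R : realType} {V : lmodType R}.

(** Finite sums of elements of [E], without scalars: the sets [E] of interest
    are stable under scaling, and linear operators that agree on [E] agree on
    these sums. *)
Inductive sum_of (E : set V) : V -> Prop :=
| sum_of0 : sum_of E 0
| sum_ofD u v : E u -> sum_of E v -> sum_of E (u + v).

Lemma sum_of_add (E : set V) u v : sum_of E u -> sum_of E v -> sum_of E (u + v).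
Proof.
elim=> [|x y Ex _ IH] Ev; first by rewrite add0r.
by rewrite -addrA; apply: sum_ofD => //; exact: IH.
Qed.

Lemma sum_of_gen (E : set V) u : E u -> sum_of E u.
Proof. by move=> Eu; rewrite -(addr0 u); apply: sum_ofD => //; exact: sum_of0. Qed.

Lemma sum_of_eq (E : set V) (S T : V -> V) u :
  is_linear S -> is_linear T -> sum_of E u ->
  (forall v, E v -> S v = T v) -> S u = T u.
Proof.
move=> Sl Tl Eu ST; elim: Eu => [|x y Ex _ IH]; first by rewrite !lin0.
by rewrite !linD// IH ST.
Qed.

End sum_of.

Section chaos.
Context {R : realType} {V : lmodType R} (ip : inner_product V) {A : choiceType}.
Context (M : A -> set V) (P : A -> V -> V).
Hypothesis Ms : forall a, linspace (M a).
Hypothesis PM : forall a u, is_orthoproj ip (M a) u (P a u).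
Implicit Types (u v w : V) (S J : {fset A}) (a b : A) (n k : nat).

Definition grad a u := u - P a u.

Definition chaos S n u := \sum_(J <- fpowerset S | #|` J| == n)
  (\big[comp/id]_(b <- J) grad b) ((\big[comp/id]_(c <- (S `\` J)%fset) P c) u).

(** Joint eigenvectors of the projections indexed by [S]; [J] is where the
    eigenvalue is 0, the possible eigenvalues being 0 and 1. *)
Definition eigen S J u := forall a, a \in S -> P a u = if a \in J then 0 else u.

Let Plin a : is_linear (P a) := proj_lin (Ms a) (PM a).

Lemma lin_comps (I : Type) (r : seq I) (T : I -> V -> V) :
  (forall i, is_linear (T i)) -> is_linear (\big[comp/id]_(i <- r) T i).
Proof.
move=> Tl; elim: r => [|i r IH]; first by rewrite big_nil.
by rewrite big_cons; exact: lin_comp.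
Qed.

Lemma grad_lin a : is_linear (grad a).
Proof. by apply: lin_sub => //; exact: lin_id. Qed.

Lemma chaos_lin S n : is_linear (chaos S n).
Proof.
apply: lin_sum => J; have := lin_comps (enum_fset J) grad_lin.
move=> /lin_comp /(_ (lin_comps (enum_fset (S `\` J)%fset) Plin)).
exact.
Qed.

(** On a joint eigenvector each factor is multiplication by 0 or 1, so a
    composition is too, in whatever order the factors come. *)
Lemma comps_eigen S J (r : seq A) (T : A -> V -> V) (p : pred A) v :
  (forall a, is_linear (T a)) -> eigen S J v -> {subset r <= S} ->
  (forall a, a \in S -> T a v = if p a then v else 0) ->
  (\big[comp/id]_(a <- r) T a) v = if all p r then v else 0.
Proof.
move=> Tl ev; elim: r => [|a r IH] rS Tp; first by rewrite big_nil.
rewrite big_cons/= IH//; last by move=> b br; apply: rS; rewrite inE br orbT.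
by case: (all p r); rewrite ?andbT ?andbF ?lin0// Tp// rS// mem_head.
Qed.

(** The projections in the term of index [I] fix [v] exactly when [J] avoids
    [S `\` I], and its gradients fix [v] exactly when [I] is included in [J]; only
    [I = J] passes both tests. *)
Lemma chaos_eigen S J n v : (J `<=` S)%fset -> eigen S J v ->
  chaos S n v = if #|` J| == n then v else 0.
Proof.
move=> JS ev; rewrite /chaos.
have term (I : {fset A}) : (I `<=` S)%fset ->
    (\big[comp/id]_(b <- I) grad b)
      ((\big[comp/id]_(c <- (S `\` I)%fset) P c) v) = if I == J then v else 0.
  move=> IS.
  rewrite (@comps_eigen S J (S `\` I)%fset P (fun a => a \notin J))//; last 2 first.
  - by move=> a /(fsubsetP (fsubsetDl S I)).
  - by move=> a /ev ->; case: ifP.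
  case: ifPn => [/allP dJ|dJ]; last first.
    rewrite lin0; last exact/lin_comps/grad_lin.
    case: eqP => // IJ; case/allP: dJ => a aSI.
    have : a \in (S `\` I)%fset by [].
    by rewrite in_fsetD IJ => /andP[].
  rewrite (@comps_eigen S J _ _ (fun a => a \in J))//; last 3 first.
  - exact: grad_lin.
  - exact/fsubsetP.
  - by move=> a /ev; rewrite /grad => ->; case: ifP; rewrite ?subr0 ?subrr.
  congr (if _ then _ else _); apply/allP/eqP => [IJ|-> //].
  apply/eqP; rewrite eqEfsubset; apply/andP; split; apply/fsubsetP => a.
    exact: IJ.
  move=> aJ; apply: contraLR aJ => aI; case: (boolP (a \in S)) => aS.
    by apply: dJ; rewrite [_ \in _](in_fsetD S I) aI aS.
  by apply: contra aS => /(fsubsetP JS).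
rewrite big_seq_cond.
rewrite (eq_bigr (fun I : {fset A} => if I == J then v else 0)); last first.
  by move=> I /andP[]; rewrite fpowersetE => /term.
rewrite -big_seq_cond -big_mkcondr/=.
case: ifPn => [/eqP Jn|Jn]; last first.
  rewrite big1// => I /andP[In /eqP IJ]; by rewrite IJ (negbTE Jn) in In.
rewrite (eq_bigl (pred1 J)); last first.
  by move=> I /=; case: (eqVneq I J) => [->|_]; rewrite ?andbF// andbT; exact/eqP.
by rewrite -big_filter filter_pred1_uniq ?fset_uniq ?fpowersetE// big_seq1.
Qed.

(** If [a] lies in just one of [J] and [I], the self-adjoint [P a] fixes one of
    the two vectors and kills the other. *)
Lemma eigen_orth S J I u v : (J `<=` S)%fset -> (I `<=` S)%fset -> J != I ->
  eigen S J u -> eigen S I v -> ip u v = 0.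
Proof.
move=> JS IS JI eu ev.
have key : exists2 a, a \in S & (a \in J) != (a \in I).
  apply: contrapT => h; case/eqP: JI; apply/fsetP => a.
  case: (boolP (a \in S)) => aS; last first.
    by rewrite (contraNF (fsubsetP JS a))// (contraNF (fsubsetP IS a)).
  by apply/eqP; apply: contra_notT h => h; exists a.
case: key => a aS; have := proj_selfadj (PM a) u v; rewrite (eu _ aS) (ev _ aS).
by do 2 case: ifP; rewrite ?ip0l ?ip0r.
Qed.

Section invariant_linspace.
Context (H : set V).
Hypothesis Hs : linspace H.
Hypothesis HP : forall a u, H u -> H (P a u).
Hypothesis PC : forall a b u, P a (P b u) = P b (P a u).

Definition eigens S := [set u | H u /\ exists2 J, (J `<=` S)%fset & eigen S J u].

(** Remove [a] from [S], decompose along the rest, and split every eigenvector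
    [v] into [v - P a v], of type [a |` J], and [P a v], of type [J]; commutation
    keeps both of them eigenvectors for the other projections. *)
Lemma sum_of_eigens S u : H u -> sum_of (eigens S) u.
Proof.
move=> Hu; elim/finSet_rect: S => S IH.
have [->|[a aS]] := fset_0Vmem S.
  by apply: sum_of_gen; split=> //; exists fset0; rewrite ?fsub0set.
have : sum_of (eigens (S `\ a)%fset) u by apply: IH; exact: fproperD1.
elim=> [|v w [Hv [J JS ev]] _ Sw]; first exact: sum_of0.
apply: sum_of_add => //; rewrite -(subrK (P a v) v).
have aJ : a \notin J by apply: contraL isT => /(fsubsetP JS); rewrite !inE eqxx.
have JS' : (J `<=` S)%fset by apply: (fsubset_trans JS); exact: fsubsetDl.
have Pv b : b \in S -> b != a -> P b v = if b \in J then 0 else v.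
  by move=> bS ba; apply: ev; rewrite !inE ba.
apply: sum_of_add; apply: sum_of_gen; split.
- by apply: linspaceB => //; exact: HP.
- exists (a |` J)%fset; first by rewrite fsubUset fsub1set aS.
  move=> b bS; rewrite linB// in_fset1U; case: eqVneq => [->|ba] /=.
    by rewrite (proj_idem (Ms a) (PM a)) subrr.
  rewrite PC// Pv//; case: ifP => _; last by [].
  by rewrite lin0// subrr.
- exact: HP.
- exists J => // b bS; case: (eqVneq b a) => [->|ba].
    by rewrite (negbTE aJ) (proj_idem (Ms a) (PM a)).
  by rewrite PC// Pv//; case: ifP => _//; rewrite lin0.
Qed.

Lemma chaos_stable S n u : H u -> H (chaos S n u).
Proof.
move=> /(sum_of_eigens S); elim=> [|v w [Hv [J JS ev]] _ Hw].
  by rewrite lin0; [case: Hs|exact: chaos_lin].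
rewrite linD; last exact: chaos_lin.
apply: linspaceD => //; rewrite (chaos_eigen _ JS ev); case: ifP => //.
by case: Hs.
Qed.

Lemma chaos_comp S n k u : H u ->
  chaos S n (chaos S k u) = if n == k then chaos S k u else 0.
Proof.
move=> /(sum_of_eigens S) Su.
have lnk := lin_comp (chaos_lin S n) (chaos_lin S k).
case: eqVneq => nk.
  apply: (sum_of_eq lnk (chaos_lin S k) Su) => v [Hv [J JS ev]] /=.
  rewrite nk (chaos_eigen k JS ev); case: ifP => Jk.
    by rewrite (chaos_eigen k JS ev) Jk.
  by rewrite lin0//; exact: chaos_lin.
apply: (sum_of_eq lnk _ Su (T := fun=> 0)) => [c x y|v [Hv [J JS ev]]] /=.
  by rewrite scaler0 addr0.
rewrite (chaos_eigen k JS ev); case: eqVneq => Jk.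
  by rewrite (chaos_eigen n JS ev) Jk eq_sym (negbTE nk).
by rewrite lin0//; exact: chaos_lin.
Qed.

Lemma chaos_selfadj S n u v : H u -> H v ->
  ip (chaos S n u) v = ip u (chaos S n v).
Proof.
have cl := chaos_lin S n.
move=> /(sum_of_eigens S) Su /(sum_of_eigens S); elim=> [|x y [Hx [J JS ex]] _ IH].
  by rewrite lin0// !ip0r.
rewrite [in RHS]linD// !ipDr IH; congr (_ + _) => {y IH}.
elim: Su => [|w z [Hw [I IS ew]] _ IH]; first by rewrite lin0// !ip0l.
rewrite linD// !ipDl IH; congr (_ + _).
rewrite (chaos_eigen n JS ex) (chaos_eigen n IS ew).
have [->|IJ] := eqVneq I J; first by case: ifP; rewrite ?ip0l ?ip0r.
by have wx := eigen_orth IS JS IJ ew ex; do 2 case: ifP; rewrite ?ip0l ?ip0r.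
Qed.

Lemma chaos_sum S N u : (#|` S| < N)%N -> H u -> \sum_(n < N) chaos S n u = u.
Proof.
move=> SN /(sum_of_eigens S) Su.
apply: (sum_of_eq _ (@lin_id _ V) Su (S := fun u => \sum_(n < N) chaos S n u)).
  by apply: lin_sum => i; exact: chaos_lin.
move=> v [Hv [J JS ev]].
have JN : (#|` J| < N)%N by apply: leq_ltn_trans SN; exact: fsubset_leq_card.
rewrite (bigD1 (Ordinal JN))//= (chaos_eigen _ JS ev) eqxx big1 ?addr0// => i iJ.
rewrite (chaos_eigen _ JS ev) ifF//; apply: contra_neqF iJ => /eqP Ji.
exact: val_inj.
Qed.

(** On vectors fixed by [P a] for all [a] outside [S], an eigenvector for [S] is
    one for [S'] with the same [J]. *)
Lemma chaos_widen S S' n u : (S `<=` S')%fset ->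
  (forall a v, a \notin S -> H v -> P a v = v) -> H u ->
  chaos S' n u = chaos S n u.
Proof.
move=> SS' Pid /(sum_of_eigens S) Su.
apply: (sum_of_eq (chaos_lin _ _) (chaos_lin _ _) Su) => v [Hv [J JS ev]].
rewrite (chaos_eigen n JS ev) (@chaos_eigen _ J)//; first exact: fsubset_trans SS'.
move=> a _; case: (boolP (a \in S)) => aS; first exact: ev.
by rewrite (contraNF (fsubsetP JS a))// Pid.
Qed.

(** [chaos S 0] keeps the eigenvectors of type [fset0]; any [Q] fixing these and
    killing what some [P a] kills coincides with it. *)
Lemma chaos0 S (Q : V -> V) u : is_linear Q ->
  (forall v, H v -> (forall a, a \in S -> P a v = v) -> Q v = v) ->
  (forall a v, P a v = 0 -> Q v = 0) -> H u -> chaos S 0 u = Q u.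
Proof.
move=> Ql Qid Q0 /(sum_of_eigens S) Su.
apply: (sum_of_eq (chaos_lin _ _) Ql Su) => v [Hv [J JS ev]].
rewrite (chaos_eigen 0 JS ev) cardfs_eq0.
case: (fset_0Vmem J) => [J0|[a aJ]].
  by rewrite J0 eqxx Qid// => a /ev; rewrite J0 inE.
rewrite ifF; last by apply/negbTE/fset0Pn; exists a.
by rewrite (Q0 a)// ev ?aJ//; exact: (fsubsetP JS).
Qed.

End invariant_linspace.

End chaos.

(** * Passage to the limit *)

(** [H] stands for the functions of all the variables, [Hm k] for those of the
    variables in [Am k], and [M0] for those of none, with projection [Q]. *)
Section chaos_limit.
Context {R : realType} {V : lmodType R} (ip : inner_product V) {A : choiceType}.
Context (M : A -> set V) (P : A -> V -> V) (H M0 : set V) (Q : V -> V).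
Context (Am : nat -> {fset A}) (Hm : nat -> set V).
Hypothesis Vc : norm_complete ip.
Hypothesis Ms : forall a, linspace (M a).
Hypothesis PM : forall a u, is_orthoproj ip (M a) u (P a u).
Hypotheses (Hs : linspace H) (Hc : norm_closed ip H).
Hypothesis HP : forall a u, H u -> H (P a u).
Hypothesis PC : forall a b u, P a (P b u) = P b (P a u).
Hypothesis (M0s : linspace M0) (QM : forall u, is_orthoproj ip M0 u (Q u)).
Hypothesis M0M : forall a, M0 `<=` M a.
Hypothesis Am_mono : forall m k, (m <= k)%N -> (Am m `<=` Am k)%fset.
Hypotheses (Hms : forall k, linspace (Hm k)) (HmH : forall k, Hm k `<=` H).
Hypothesis HmP : forall k a u, Hm k u -> Hm k (P a u).
Hypothesis Hm_id : forall k a u, a \notin Am k -> Hm k u -> P a u = u.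
Hypothesis Hm0 : forall k u, Hm k u -> (forall a, a \in Am k -> P a u = u) ->
  M0 u.
Hypothesis Hm_dense : forall K, linspace K -> norm_closed ip K ->
  (forall k, Hm k `<=` K) -> H `<=` K.
Implicit Types (u v w : V) (n k m : nat).

Local Notation sqn := (sqn ip).
Local Notation norm_cvg := (norm_cvg ip).
Local Notation chaos := (chaos P).

Let cl S n : is_linear (chaos S n). Proof. exact: (chaos_lin Ms PM). Qed.

Let Ql : is_linear Q. Proof. exact: (proj_lin M0s QM). Qed.

Let Q_le u : sqn (Q u) <= sqn u. Proof. exact: (proj_le u M0s QM). Qed.

Lemma chaos_le S n u : H u -> sqn (chaos S n u) <= sqn u.
Proof.
move=> Hu; apply: (@selfadj_idem_contraction _ _ ip H) => //.
- exact: (chaos_stable Ms PM).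
- by rewrite (chaos_comp Ms PM Hs)// eqxx.
- by move=> v w; exact: (chaos_selfadj Ms PM).
Qed.

Lemma chaos_stationary k m n u : Hm k u -> (k <= m)%N ->
  chaos (Am m) n u = chaos (Am k) n u.
Proof.
move=> Hu km; apply: (chaos_widen Ms PM (Hms k) (HmP (k:=k)) PC) => //.
- exact: Am_mono.
- by move=> a v; exact: Hm_id.
Qed.

Lemma chaos_cvg n u : H u -> exists l, norm_cvg (fun m => chaos (Am m) n u) l.
Proof.
move=> Hu; pose T m := chaos (Am m) n.
have Tb m v : H v -> sqn (T m v) <= 1 * sqn v.
  by move=> Hv; rewrite mul1r; exact: chaos_le.
have Tl m : is_linear_on H (T m) by move=> c v w _ _; exact: cl.
suff /(_ _ Hu)[] : H `<=` [set u | H u /\ exists l, norm_cvg (T^~ u) l] by [].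
apply: Hm_dense.
- exact: linspace_convergent.
- exact: (closed_convergent Hs Hc ltr01).
- move=> k v Hv; split; first exact: HmH Hv.
  exists (chaos (Am k) n v); apply: (@norm_cvg_eventually _ _ _ _ _ k) => m km.
  exact: (chaos_stationary _ Hv km).
Qed.

(** On [Hm k], [chaos (Am m) 0] is [Q] from rank [k] on: a vector killed by some
    [P a] is orthogonal to [M a], hence to [M0]. *)
Lemma chaos0_cvg u : H u -> norm_cvg (fun m => chaos (Am m) 0 u) (Q u).
Proof.
move=> Hu; pose T m u := chaos (Am m) 0 u - Q u.
have Tb m v : H v -> sqn (T m v) <= 4 * sqn v.
  move=> Hv; have := sqnB_le ip (chaos (Am m) 0 v) 0 (Q v).
  by rewrite subr0 sub0r sqnN; have := chaos_le (Am m) 0 Hv; have := Q_le v; lra.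
have Tl m : is_linear_on H (T m) by move=> c v w _ _; exact: lin_sub.
suff /(_ _ Hu)[_ Tu] : H `<=` [set u | H u /\ norm_cvg (T^~ u) 0].
  have := norm_cvgD Tu (norm_cvg_cst ip (Q u)); rewrite add0r.
  by under eq_fun do rewrite subrK.
apply: Hm_dense.
- exact: linspace_vanish.
- by apply: (closed_vanish Hs Hc _ Tl Tb).
- move=> k v Hv; split; first exact: HmH Hv.
  apply: (@norm_cvg_eventually _ _ _ _ _ k) => m km; apply/eqP; rewrite subr_eq0.
  rewrite (chaos_stationary _ Hv km); apply/eqP.
  apply: (chaos0 Ms PM (Hms k) (HmP (k:=k)) PC) => //.
    by move=> w Hw Pw; apply: (proj_fix M0s QM); exact: Hm0 Pw.
  move=> a w Pw0; apply: (ip_eq0 ip).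
  rewrite (proj_selfadj QM) (proj_idem M0s QM).
  by have := (PM a w).2 _ (M0M a (QM w).1); rewrite Pw0 subr0.
Qed.

Section limits.
Context (L : nat -> V -> V).
Hypothesis LP : forall n u, H u -> norm_cvg (fun m => chaos (Am m) n u) (L n u).

Lemma limit_stable n u : H u -> H (L n u).
Proof.
by move=> Hu; apply: Hc (LP n Hu) => m; exact: (chaos_stable Ms PM).
Qed.

Lemma limit_lin n c u v : H u -> H v -> L n (c *: u + v) = c *: L n u + L n v.
Proof.
move=> Hu Hv; have Huv : H (c *: u + v) by case: Hs => _; exact.
apply: (norm_cvg_unique (LP n Huv)); under eq_fun do rewrite cl.
by apply: norm_cvg_lin; exact: LP.
Qed.

Lemma limit_selfadj n u v : H u -> H v -> ip (L n u) v = ip u (L n v).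
Proof.
move=> Hu Hv; have := norm_cvg_ip (w := v) (LP n Hu).
have := norm_cvg_ip (w := u) (LP n Hv).
rewrite (ipC ip u); under eq_fun do rewrite ipC -(chaos_selfadj Ms PM Hs HP PC)//.
by move=> c1 c2; apply: (cvg_unique (@Rhausdorff R) c2 c1).
Qed.

Lemma limit_orth n k u v : H u -> H v ->
  ip (L n u) (L k v) = if n == k then ip u (L k v) else 0.
Proof.
move=> Hu Hv; have := norm_cvg_ip2 (LP n Hu) (LP k Hv).
have -> : (fun m => ip (chaos (Am m) n u) (chaos (Am m) k v)) =
    (fun m => if n == k then ip u (chaos (Am m) k v) else 0).
  apply/funext => m; rewrite (chaos_selfadj Ms PM Hs HP PC)//; last first.
    exact: (chaos_stable Ms PM).
  by rewrite (chaos_comp Ms PM Hs HP PC)//; case: ifP; rewrite ?ip0r.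
case: eqVneq => _ c1; last first.
  exact: (cvg_unique (@Rhausdorff R) c1 (cvg_cst _)).
apply: (cvg_unique (@Rhausdorff R) c1).
have := norm_cvg_ip (w := u) (LP k Hv); rewrite (ipC ip u).
by under eq_fun do rewrite ipC.
Qed.

Lemma limit_idem n u : H u -> L n (L n u) = L n u.
Proof.
move=> Hu; have HL := limit_stable n Hu; have HLL := limit_stable n HL.
have Hd := linspaceB Hs HLL HL.
apply: subr0_eq; apply: (ip_eq0 ip); rewrite {1}ipBl.
by rewrite (limit_selfadj n HL Hd) (limit_orth _ _ Hu Hd) eqxx
  (limit_selfadj n Hu Hd) subrr.
Qed.

Lemma limit0 u : H u -> L 0 u = Q u.
Proof. by move=> Hu; apply: (norm_cvg_unique (LP 0 Hu)); exact: chaos0_cvg. Qed.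

(** Expanding the square with the orthogonality relations, the sum [s] of the
    projections satisfies [|s|^2 = (u, s)]. *)
Lemma limit_sum_le N u : H u -> sqn (\sum_(n < N) L n u) <= sqn u.
Proof.
move=> Hu; set s := \sum_(n < N) L n u.
have ss : ip s s = ip u s.
  rewrite [in LHS]/s ip_suml [in RHS]/s ip_sumr; apply: eq_bigr => n _.
  rewrite /s ip_sumr (bigD1 n)//= limit_orth// eqxx big1 ?addr0// => k kn.
  by rewrite limit_orth// ifF//; apply: contraNF kn => /eqP nk; apply/eqP/val_inj.
by have := ip_ge0 ip (u - s); rewrite -/(sqn _) sqnB -ss -/(sqn s); lra.
Qed.

(** On [Hm k] only the [n] up to the cardinal of [Am k] contribute, and the
    partial sums are eventually exactly [u]. *)
Lemma limit_sum u : H u ->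
  norm_cvg (fun N => Q u + \sum_(1 <= n < N.+1) L n u) u.
Proof.
move=> Hu; pose T N v := \sum_(n < N.+1) L n v - v.
have TE N v : H v -> Q v + \sum_(1 <= n < N.+1) L n v = T N v + v.
  by move=> Hv; rewrite subrK big_ord_recl /= limit0// big_add1 big_mkord.
have Tb N v : H v -> sqn (T N v) <= 4 * sqn v.
  move=> Hv; have := sqnB_le ip (\sum_(n < N.+1) L n v) 0 v.
  by rewrite subr0 sub0r sqnN; have := limit_sum_le N.+1 Hv; lra.
have Tl N : is_linear_on H (T N).
  move=> c v w Hv Hw; rewrite /T; under eq_bigr do rewrite limit_lin//.
  by rewrite big_split/= -scaler_sumr opprD addrACA scalerBr.
suff /(_ _ Hu)[_ Tu] : H `<=` [set u | H u /\ norm_cvg (T^~ u) 0].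
  have := norm_cvgD Tu (norm_cvg_cst ip u); rewrite add0r.
  by under eq_fun do rewrite -TE//.
apply: Hm_dense.
- exact: linspace_vanish.
- by apply: (closed_vanish Hs Hc _ Tl Tb).
- move=> k v Hv; have Hv' := HmH Hv; split=> //.
  apply: (@norm_cvg_eventually _ _ _ _ _ #|` Am k|) => N kN.
  apply/eqP; rewrite subr_eq0; apply/eqP.
  rewrite -[RHS](chaos_sum Ms PM Hs HP PC (S := Am k) (N := N.+1))//.
  apply: eq_bigr => n _; apply: (norm_cvg_unique (LP n Hv')).
  apply: (@norm_cvg_eventually _ _ _ _ _ k) => m km.
  exact: (chaos_stationary _ Hv km).
Qed.

End limits.
End chaos_limit.

(** * The Hilbert space of classes of square integrable functions *)

Section square_integrable.
Context d (Omega : measurableType d) (R : realType) (P : probability Omega R).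
Implicit Types (F G K : Omega -> R) (W : set Omega).
Local Notation L2 := (Lfun P 2%:E).

Lemma L2_measurable F : F \in L2 -> measurable_fun setT F.
Proof. by move=> /sub_Lfun_mfun; rewrite inE. Qed.

Lemma L2P F : F \in L2 <->
  measurable_fun setT F /\ (\int[P]_w (F w ^+ 2)%:E < +oo)%E.
Proof.
split=> [F2|[mF iF]].
  split; first exact: L2_measurable.
  have /integrableP[_] := Lfun2_integrable_sqr F2; apply: le_lt_trans.
  by under [leRHS]eq_integral do rewrite /= ger0_norm ?sqr_ge0//.
apply/andP; split; rewrite inE//= /finite_norm unlock poweR_lty//.
rewrite (eq_integral (fun w => (F w ^+ 2)%:E)) // => w _ /=.
by rewrite powR_mulrn// real_normK ?num_real.
Qed.

Lemma L2_lin c F G : F \in L2 -> G \in L2 -> (fun w => c * F w + G w) \in L2.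
Proof.
move=> F2 G2; have [_ /(_ c _ _ F2 G2)] := Lfun_submod_closed P (lee1n 2).
exact.
Qed.

Lemma L2D F G : F \in L2 -> G \in L2 -> F \+ G \in L2.
Proof.
move=> F2 G2; rewrite (_ : _ \+ _ = fun w => 1 * F w + G w) ?L2_lin//.
by apply/funext => w; rewrite mul1r.
Qed.

Lemma L2B F G : F \in L2 -> G \in L2 -> F \- G \in L2.
Proof.
move=> F2 G2; rewrite (_ : _ \- _ = fun w => -1 * G w + F w) ?L2_lin//.
by apply/funext => w /=; rewrite mulN1r addrC.
Qed.

Lemma L2_cst c : cst c \in L2. Proof. exact: Lfun_cst. Qed.

Lemma L2_le F G : measurable_fun setT F -> (forall w, `|F w| <= `|G w|) ->
  G \in L2 -> F \in L2.
Proof.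
move=> mF FG /L2P[mG iG]; apply/L2P; split=> //; apply: le_lt_trans iG.
apply: ge0_le_integral => //.
- by move=> w _; rewrite lee_fin sqr_ge0.
- by apply/measurable_EFinP; exact: measurable_funX.
- by apply/measurable_EFinP; exact: measurable_funX.
- move=> w _; rewrite lee_fin -(real_normK (num_real (F w))).
  by rewrite -(real_normK (num_real (G w))) lerXn2r ?nnegrE.
Qed.

Lemma L2_indic W : measurable W -> (\1_W : Omega -> R) \in L2.
Proof.
move=> mW; apply: L2_le (L2_cst 1); first exact: measurable_indic.
by move=> w; rewrite indicE normr1; case: (_ \in _); rewrite ?normr1// normr0.
Qed.

Lemma L2_indicM W F : measurable W -> F \in L2 -> \1_W \* F \in L2.
Proof.
move=> mW F2; apply: (L2_le _ _ F2).
  by apply: measurable_funM; [exact: measurable_indic|exact: L2_measurable].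
move=> w /=; rewrite indicE normrM ler_piMl//.
by case: (_ \in _); rewrite ?normr1// normr0.
Qed.

Lemma L2M_L1 F G : F \in L2 -> G \in L2 -> F \* G \in Lfun P 1.
Proof. exact: Lfun2_mul_Lfun1. Qed.

Lemma L2M_integrable F G : F \in L2 -> G \in L2 ->
  P.-integrable setT (EFin \o (F \* G)).
Proof. by move=> F2 G2; apply/Lfun1_integrable; exact: L2M_L1. Qed.

Lemma L2_integrable F : F \in L2 -> P.-integrable setT (EFin \o F).
Proof.
move=> F2; apply/Lfun1_integrable; apply: Lfun_subset12 => //.
exact: fin_num_measure.
Qed.

(** A class modulo almost sure equality is represented by the functional
    G |-> E[F G] on square integrable G, which determines F almost surely. The
    classes then form a linear subspace of a function space, in which equality
    is almost sure equality of representatives ([pairing_ae]). *)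
Definition pairing F G : R := if G \in L2 then fine ('E_P[(F \* G)%R])%E else 0.

Lemma pairing_lin c F G : F \in L2 -> G \in L2 ->
  pairing (fun w => c * F w + G w) = c *: pairing F + pairing G.
Proof.
move=> F2 G2; apply/funext => K; rewrite /pairing !fctE.
case: ifPn => K2; last by rewrite scaler0 addr0.
have -> : (fun w => c * F w + G w) \* K = (c \o* (F \* K)) \+ (G \* K).
  by apply/funext => w /=; ring.
rewrite expectationD; last 2 first.
- by rewrite -[X in X \in _]/(c \o* _); apply: Lfun_scale => //; exact: L2M_L1.
- exact: L2M_L1.
rewrite expectationZl ?L2M_L1// fineD ?fin_numM ?expectation_fin_num ?L2M_L1//.
by rewrite fineM ?expectation_fin_num ?L2M_L1.
Qed.

Lemma eq0_ae F : F \in L2 -> ('E_P[(F \* F)%R] = 0)%E -> F = cst 0 %[ae P].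
Proof.
move=> F2; rewrite unlock => F0.
have mFF : measurable_fun setT (EFin \o (F \* F)).
  apply/measurable_EFinP.
  by apply: measurable_funM; exact: L2_measurable.
have /(ae_eq_integral_abs P measurableT mFF) :
    (\int[P]_w `|((F \* F)%R w)%:E| = 0)%E.
  rewrite -[RHS]F0; apply: eq_integral => w _ /=.
  by rewrite -expr2 ger0_norm ?sqr_ge0// expr2.
apply: filterS => w /= /(_ I)[] /eqP.
by rewrite mulf_eq0 orbb => /eqP.
Qed.

(** Testing the equality of functionals at [F \- G] gives E[(F - G)^2] = 0. *)
Lemma pairing_ae F G : F \in L2 -> G \in L2 ->
  (pairing F = pairing G) <-> (F = G %[ae P]).
Proof.
move=> F2 G2; split=> [FG|FG].
  have D2 := L2B F2 G2; suff : F \- G = cst 0 %[ae P].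
    by apply: filterS => w /= /(_ I) /eqP; rewrite subr_eq0 => /eqP.
  apply: eq0_ae => //.
  have := congr1 (@^~ (F \- G)) FG; rewrite /pairing D2 => FGD.
  have -> : (F \- G) \* (F \- G) = (F \* (F \- G)) \- (G \* (F \- G)).
    by apply/funext => w /=; ring.
  rewrite expectationB ?L2M_L1//.
  rewrite -[X in (X - _)%E]fineK ?expectation_fin_num ?L2M_L1// FGD.
  rewrite fineK ?expectation_fin_num ?L2M_L1//.
  by rewrite subee ?expectation_fin_num ?L2M_L1.
apply/funext => K; rewrite /pairing; case: ifPn => // K2; congr fine.
rewrite unlock; apply: ae_eq_integral => //.
- exact: (measurable_int P (L2M_integrable F2 K2)).
- exact: (measurable_int P (L2M_integrable G2 K2)).
- by apply: filterS FG => w /= /(_ I) -> _.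
Qed.

Definition is_pairing : {pred (Omega -> R) -> R} :=
  [pred phi | `[< exists2 F, F \in L2 & phi = pairing F >]].

Lemma is_pairing_submod_closed : submod_closed is_pairing.
Proof.
split.
  apply/asboolP; exists (cst 0); first exact: L2_cst.
  apply/funext => G; rewrite /pairing; case: ifP => // _.
  rewrite (_ : cst 0 \* G = cst 0) ?expectation_cst//.
  by apply/funext => w /=; rewrite mul0r.
move=> c _ _ /asboolP[F F2 ->] /asboolP[G G2 ->]; apply/asboolP.
by exists (fun w => c * F w + G w); rewrite ?L2_lin// pairing_lin.
Qed.

HB.instance Definition _ := GRing.isSubmodClosed.Build R ((Omega -> R) -> R)
  is_pairing is_pairing_submod_closed.

Record L2class := L2Class {
  pairing_of : (Omega -> R) -> R ;
  _ : pairing_of \in is_pairing }.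
HB.instance Definition _ := [isSub for pairing_of].
HB.instance Definition _ := [Choice of L2class by <:].
HB.instance Definition _ := [SubChoice_isSubLmodule of L2class by <:].

End square_integrable.

Section L2_inner_product.
Context d (Omega : measurableType d) (R : realType) (P : probability Omega R).
Implicit Types (F G K : Omega -> R) (W : set Omega) (u v : L2class P).
Local Notation L2 := (Lfun P 2%:E).

(** The class of [F]; meaningful for [F] in [L2]. *)
Definition cls F : L2class P := insubd 0 (pairing P F).

Definition rep u : Omega -> R :=
  xget (cst 0) [set F | F \in L2 /\ cls F = u].

Lemma val_cls F : F \in L2 -> \val (cls F) = pairing P F.
Proof. by move=> F2; apply: insubdK; apply/asboolP; exists F. Qed.

Lemma repP u : rep u \in L2 /\ cls (rep u) = u.
Proof.
have : exists F, [set F | F \in L2 /\ cls F = u] F.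
  have /asboolP[F F2 uF] := valP u; exists F; split=> //.
  by apply: val_inj; rewrite val_cls.
by case=> F; exact: xgetI.
Qed.

Lemma rep_L2 u : rep u \in L2. Proof. by case: (repP u). Qed.

Lemma cls_rep u : cls (rep u) = u. Proof. by case: (repP u). Qed.

Lemma cls_eq F G : F \in L2 -> G \in L2 ->
  (cls F = cls G) <-> (F = G %[ae P]).
Proof.
move=> F2 G2; rewrite -pairing_ae// -!val_cls//.
by split=> [->|/val_inj].
Qed.

Lemma cls_lin c F G : F \in L2 -> G \in L2 ->
  cls (fun w => c * F w + G w) = c *: cls F + cls G.
Proof.
move=> F2 G2; apply: val_inj; rewrite val_cls ?L2_lin// pairing_lin//.
by rewrite -!val_cls.
Qed.

Lemma clsB F G : F \in L2 -> G \in L2 -> cls (F \- G) = cls F - cls G.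
Proof.
move=> F2 G2; rewrite addrC -scaleN1r -cls_lin//; congr cls.
by apply/funext => w /=; rewrite mulN1r addrC.
Qed.

Lemma clsD F G : F \in L2 -> G \in L2 -> cls (F \+ G) = cls F + cls G.
Proof.
move=> F2 G2; rewrite -(scale1r (cls F)) -cls_lin//; congr cls.
by apply/funext => w /=; rewrite mul1r.
Qed.

Lemma cls_cst0 : cls (cst 0) = 0.
Proof.
have := clsB (L2_cst P 0) (L2_cst P 0); rewrite subrr => <-; congr cls.
by apply/funext => w /=; rewrite subr0.
Qed.

Lemma L2_sum (I : Type) (r : seq I) (p : pred I) (F : I -> Omega -> R) :
  (forall i, p i -> F i \in L2) ->
  (fun w => \sum_(i <- r | p i) F i w) \in L2 /\
  cls (fun w => \sum_(i <- r | p i) F i w) = \sum_(i <- r | p i) cls (F i).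
Proof.
move=> F2; elim: r => [|i r [IH IHc]].
  under eq_fun do rewrite big_nil; rewrite big_nil.
  by split; [exact: L2_cst|exact: cls_cst0].
under eq_fun do rewrite big_cons; rewrite big_cons.
case: ifPn => pi; last by [].
have -> : (fun w => F i w + \sum_(j <- r | p j) F j w) =
  F i \+ (fun w => \sum_(j <- r | p j) F j w) by [].
by rewrite clsD ?F2// IHc; split => //; apply: L2D => //; exact: F2.
Qed.

Definition L2ip u v : R := \val u (rep v).

Lemma L2ip_cls F G : F \in L2 -> G \in L2 ->
  ('E_P[(F \* G)%R] = (L2ip (cls F) (cls G))%:E)%E.
Proof.
move=> F2 G2; rewrite /L2ip val_cls// /pairing rep_L2.
rewrite fineK ?expectation_fin_num ?L2M_L1 ?rep_L2// unlock.
have GG : G = rep (cls G) %[ae P] by apply/cls_eq; rewrite ?rep_L2 ?cls_rep.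
apply: ae_eq_integral => //.
- exact: (measurable_int P (L2M_integrable F2 G2)).
- exact: (measurable_int P (L2M_integrable F2 (rep_L2 _))).
- by apply: filterS GG => w /= /(_ I) <- _.
Qed.

Lemma L2ipC u v : L2ip u v = L2ip v u.
Proof.
apply: EFin_inj; rewrite -(cls_rep u) -(cls_rep v) -!L2ip_cls ?rep_L2//.
by congr expectation; apply/funext => w /=; rewrite mulrC.
Qed.

Lemma L2ipPl c u v w : L2ip (c *: u + v) w = c * L2ip u w + L2ip v w.
Proof. by []. Qed.

Lemma L2ip_ge0 u : 0 <= L2ip u u.
Proof.
rewrite -lee_fin -(cls_rep u) -L2ip_cls ?rep_L2//.
by apply: expectation_ge0 => w /=; rewrite -expr2 sqr_ge0.
Qed.

Lemma L2ip_eq0 u : L2ip u u = 0 -> u = 0.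
Proof.
move=> u0; rewrite -(cls_rep u) -cls_cst0; apply/cls_eq; rewrite ?rep_L2 ?L2_cst//.
by apply: eq0_ae; rewrite ?rep_L2// L2ip_cls ?rep_L2// cls_rep u0.
Qed.

Definition L2inner := InnerProduct L2ipC L2ipPl L2ip_ge0 L2ip_eq0.

Lemma sqn_cls F : F \in L2 ->
  (\int[P]_w (F w ^+ 2)%:E = (sqn L2inner (cls F))%:E)%E.
Proof. by move=> F2; rewrite /sqn -L2ip_cls// unlock. Qed.

Lemma Lnorm_cls F : F \in L2 ->
  ('N[P]_2%:E[EFin \o F] = (Num.sqrt (sqn L2inner (cls F)))%:E)%E.
Proof.
move=> F2; rewrite unlock.
rewrite (eq_integral (fun w => (F w ^+ 2)%:E)); last first.
  by move=> w _ /=; rewrite powR_mulrn// real_normK ?num_real.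
by rewrite sqn_cls// poweR_EFin powR12_sqrt// (ip_ge0 L2inner).
Qed.

Lemma L2_cvg_cls (F_ : nat -> Omega -> R) F : (forall n, F_ n \in L2) ->
  F \in L2 ->
  L2_cvg P F_ F <-> norm_cvg L2inner (fun n => cls (F_ n)) (cls F).
Proof.
move=> F2 FL2; rewrite /L2_cvg /norm_cvg.
have -> : (fun n => 'N[P]_2%:E[EFin \o (F_ n \- F)%R])%E =
    EFin \o (fun n => Num.sqrt (sqn L2inner (cls (F_ n) - cls F))).
  by apply/funext => n; rewrite Lnorm_cls ?L2B// clsB.
set s := fun n => sqn L2inner _.
split=> [/fine_cvgP[_]|s0].
  move=> /= s0.
  rewrite (_ : s = fun n => Num.sqrt (s n) * Num.sqrt (s n)); last first.
    by apply/funext => n; rewrite -expr2 sqr_sqrtr// (ip_ge0 L2inner).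
  rewrite -(mulr0 0); exact: cvgM.
apply/fine_cvgP; split; first exact: nearW.
have := @sqrt_continuous R 0; rewrite /continuous_at sqrtr0 => sqrt0.
exact: (cvg_comp _ _ s0 sqrt0).
Qed.

End L2_inner_product.

Section sub_sigma_algebra.
Context d (Omega : measurableType d) (R : realType) (P : probability Omega R).
Implicit Types (G : set (set Omega)) (F : Omega -> R).
Local Notation L2 := (Lfun P 2%:E).
Local Notation cls := (cls P).
Local Notation ip := (L2inner P).

Definition sub_sigma G := sigma_algebra setT G /\ G `<=` measurable.

Definition meas_wrt G F := forall U : set R, measurable U -> G (F @^-1` U).

Lemma meas_wrtP G F : sub_sigma G ->
  meas_wrt G F <-> measurable_fun [set: g_sigma_algebraType G] F.
Proof.
move=> [sG _]; split=> [GF _ U mU|mF U mU].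
  by rewrite setTI; apply: sub_sigma_algebra; exact: GF.
by have := mF measurableT _ mU; rewrite setTI /measurable/= sigma_algebra_id.
Qed.

Lemma meas_wrt_measurable G F : sub_sigma G -> meas_wrt G F ->
  measurable_fun setT F.
Proof. by move=> [_ Gm] GF _ U mU; rewrite setTI; apply/Gm/GF. Qed.

Definition L2_of G : set (L2class P) :=
  [set u | exists2 F, F \in L2 /\ meas_wrt G F & cls F = u].

Lemma L2_of_mono G G' : G `<=` G' -> L2_of G `<=` L2_of G'.
Proof. by move=> GG' _ [F [F2 GF] <-]; exists F => //; split => // U /GF/GG'. Qed.

Lemma linspace_L2_of G : sub_sigma G -> linspace (L2_of G).
Proof.
move=> sG; split.
  exists (cst 0); rewrite ?cls_cst0//; split; first exact: L2_cst.
  by apply/meas_wrtP.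
move=> c _ _ [F [F2 /(meas_wrtP _ sG) GF] <-] [K [K2 /(meas_wrtP _ sG) GK] <-].
exists (fun w => c * F w + K w); last exact: cls_lin.
split; first exact: L2_lin.
by apply/meas_wrtP => //; apply: measurable_funD => //; exact: measurable_funM.
Qed.

End sub_sigma_algebra.

Arguments L2_of {d Omega R} P G.

(** * Completeness *)

Section completeness.
Context d (Omega : measurableType d) (R : realType) (P : probability Omega R).
Implicit Types (G : set (set Omega)) (F : Omega -> R).
Local Notation L2 := (Lfun P 2%:E).
Local Notation cls := (cls P).
Local Notation sqn := (sqn (L2inner P)).

(** From [2 |x| <= c x^2 + c^-1], which is [0 <= (c |x| - 1)^2]. *)
Lemma int_norm_le F (c : R) : F \in L2 -> 0 < c -> sqn (cls F) < (c ^+ 2)^-1 ->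
  (\int[P]_w `|F w|%:E <= c^-1%:E)%E.
Proof.
move=> F2 c0 Fc; have mF := L2_measurable F2.
have mF2 : measurable_fun setT (fun w => (F w ^+ 2)%:E).
  by apply/measurable_EFinP; exact: measurable_funX.
have c2 : 0 <= c / 2 by rewrite divr_ge0// ltW.
apply: (@le_trans _ _ (\int[P]_w ((c / 2)%:E * (F w ^+ 2)%:E + (c^-1 / 2)%:E)))%E.
  apply: ge0_le_integral => //.
  - by apply/measurable_EFinP; exact: measurableT_comp.
  - by apply: emeasurable_funD => //; exact: measurable_funeM.
  - move=> w _; rewrite -EFinM -EFinD lee_fin.
    have := sqr_ge0 (c * `|F w| - 1).
    rewrite -(real_normK (num_real (F w))) => h.
    rewrite -(ler_pM2l c0) mulrDr (_ : c * (c^-1 / 2) = 1 / 2); last first.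
      by field; exact: lt0r_neq0.
    lra.
rewrite ge0_integralD//; last 3 first.
- by move=> w _; rewrite -EFinM lee_fin mulr_ge0// sqr_ge0.
- exact: measurable_funeM.
- by move=> w _; rewrite lee_fin divr_ge0// invr_ge0 ltW.
rewrite ge0_integralZl//; last first.
- by move=> w _; rewrite lee_fin sqr_ge0.
have -> : (\int[P]_w (c^-1 / 2)%:E = (c^-1 / 2)%:E)%E.
  by have := expectation_cst P (c^-1 / 2); rewrite unlock.
rewrite sqn_cls//.
rewrite -EFinM -EFinD lee_fin.
have : c / 2 * sqn (cls F) <= c / 2 * (c ^+ 2)^-1 by rewrite ler_wpM2l// ltW.
rewrite (_ : c / 2 * (c ^+ 2)^-1 = c^-1 / 2); last by field; exact: lt0r_neq0.
lra.
Qed.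

(** The increments have summable L1 norms, so their absolute values have an
    almost surely finite sum. *)
Lemma ae_cvg (F_ : nat -> Omega -> R) : (forall j, F_ j \in L2) ->
  (forall j, sqn (cls (F_ j.+1) - cls (F_ j)) < ((2 ^ j.+1)%:R ^+ 2)^-1) ->
  {ae P, forall w, cvgn (F_ ^~ w)}.
Proof.
move=> F2 Fj; pose g j w := `|F_ j.+1 w - F_ j w|.
have g0 j w : (0 <= (g j w)%:E)%E by rewrite lee_fin normr_ge0.
have mg j : measurable_fun setT (fun w => (g j w)%:E).
  apply/measurable_EFinP; apply: measurableT_comp => //.
  by apply: measurable_funB; exact: L2_measurable.
have gj j : (\int[P]_w (g j w)%:E <= (1 / (2 ^ j.+1)%:R)%:E)%E.
  rewrite div1r; apply: (@int_norm_le (F_ j.+1 \- F_ j)); first exact: L2B.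
    by rewrite ltr0n expn_gt0.
  by rewrite clsB.
have int_g : P.-integrable setT (fun w => \sum_(0 <= j <oo) (g j w)%:E)%E.
  apply/integrableP; split.
    apply: (@ge0_emeasurable_sum _ _ _ setT (fun j w => (g j w)%:E) xpredT).
      by move=> j w _ _; exact: g0.
    by move=> j _; exact: mg.
  rewrite (eq_integral (fun w => \sum_(0 <= j <oo) (g j w)%:E)%E); last first.
    by move=> w _; rewrite gee0_abs// nneseries_ge0.
  rewrite integral_nneseries//.
  (* The sum of the 2^-(j+1) is bounded by 1. *)
  have := @epsilon_trick R (fun=> 0%E) 1 xpredT (fun=> lexx _) ler01.
  rewrite [X in (_ <= X + _)%E]eseries0// add0e => h.
  apply: (@le_lt_trans _ _ 1%:E); last exact: ltry.
  apply: le_trans h; apply: lee_nneseries => [j _ _|j _]; last by rewrite add0e.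
  by apply: integral_ge0 => w _; exact: g0.
apply: filterS (integrable_ae measurableT int_g) => w /(_ I) gw.
have Fw n : F_ n w = F_ 0%N w + series (telescope (F_ ^~ w)) n.
  exact: (eq_sum_telescope (F_ ^~ w)).
have : cvgn (series (telescope (F_ ^~ w))).
  apply: normed_cvg; apply: nondecreasing_is_cvgn.
    by apply: nondecreasing_series => j _ _; exact: normr_ge0.
  exists (fine (\sum_(0 <= j <oo) (g j w)%:E)%E) => _ [n _ <-].
  rewrite -lee_fin fineK// /series/= -sumEFin.
  by apply: (@nneseries_lim_ge _ (fun j => (g j w)%:E)) => j _ _; exact: g0.
move=> cs.
rewrite (_ : F_ ^~ w = fun n => F_ 0%N w + series (telescope (F_ ^~ w)) n).
  by apply: is_cvgD => //; exact: is_cvg_cst.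
exact/funext.
Qed.

Lemma limn_einf_le (u : nat -> \bar R) (e : \bar R) N :
  (forall n, (N <= n)%N -> (u n <= e)%E) -> (limn_einf u <= e)%E.
Proof.
move=> ue; rewrite limn_einf_lim; apply: lime_le; first exact: is_cvg_einfs.
apply: nearW => n; apply: (@le_trans _ _ (u (maxn n N))).
  by apply: ereal_inf_lbound; exists (maxn n N) => //=; exact: leq_maxl.
by apply: ue; exact: leq_maxr.
Qed.

(** A rapidly Cauchy subsequence converges almost everywhere; its upper limit
    is measurable for the sub-sigma-algebra, and Fatou's lemma bounds the
    distance to it. *)
Lemma L2_complete G (F_ : nat -> Omega -> R) : sub_sigma G ->
  (forall n, F_ n \in L2 /\ meas_wrt G (F_ n)) ->
  norm_cauchy (L2inner P) (fun n => cls (F_ n)) ->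
  exists2 F, F \in L2 /\ meas_wrt G F &
    norm_cvg (L2inner P) (fun n => cls (F_ n)) (cls F).
Proof.
move=> sG FP FC; have F2 n : F_ n \in L2 by case: (FP n).
have GF n : meas_wrt G (F_ n) by case: (FP n).
have e0 j : 0 < ((2 ^ j.+1)%:R ^+ 2)^-1 :> R.
  by rewrite invr_gt0 exprn_gt0// ltr0n expn_gt0.
have [k kP] := fast_cauchy e0 FC.
pose F w := fine (limn_esup (fun j => (F_ (k j) w)%:E)).
have GFF : meas_wrt G F.
  apply/meas_wrtP => //; apply: measurableT_comp; first exact: fine_measurable.
  apply: measurable_fun_limn_esup => j; apply/measurable_EFinP.
  exact/meas_wrtP.
have mF : measurable_fun setT F by exact: meas_wrt_measurable GFF.
have FkF : {ae P, forall w, (fun j => F_ (k j) w) @ \oo --> F w}.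
  have := @ae_cvg (fun j => F_ (k j)) (fun j => F2 (k j)) (fun j => (kP j).2).
  apply: filterS => w cw.
  have cE : (fun j => (F_ (k j) w)%:E) @ \oo --> (limn (fun j => F_ (k j) w))%:E.
    by apply: cvg_EFin => //; exact: nearW.
  rewrite /F is_cvg_limn_esupE; last by apply/cvg_ex; eexists; exact: cE.
  by rewrite (cvg_lim _ cE).
have bound n (e : R) N :
    (forall m, (N <= m)%N -> sqn (cls (F_ n) - cls (F_ m)) <= e) ->
    (\int[P]_w ((F_ n w - F w) ^+ 2)%:E <= e%:E)%E.
  move=> ne; have mFn := L2_measurable (F2 n).
  pose h j w := ((F_ n w - F_ (k j) w) ^+ 2)%:E.
  have mh j : measurable_fun setT (h j).
    apply/measurable_EFinP; apply: measurable_funX; apply: measurable_funB => //.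
    exact: L2_measurable.
  rewrite (@ae_eq_integral _ _ _ P setT (fun w => limn_einf (h ^~ w)))//; last 3 first.
  - apply/measurable_EFinP; apply: measurable_funX.
    exact: measurable_funB.
  - apply: measurableT_comp => //; apply: measurable_fun_limn_esup => j.
    exact: measurableT_comp.
  - apply: filterS FkF => w cw _.
    have hc : h ^~ w @ \oo --> ((F_ n w - F w) ^+ 2)%:E.
      apply: cvg_EFin; first exact: nearW.
      rewrite (_ : fine \o _ =
          fun j => (F_ n w - F_ (k j) w) * (F_ n w - F_ (k j) w)).
        by rewrite expr2; apply: cvgM; apply: cvgB => //; exact: cvg_cst.
      by apply/funext => j; rewrite /= expr2.
    rewrite is_cvg_limn_einfE; last by apply/cvg_ex; eexists; exact: hc.
    by rewrite (cvg_lim _ hc).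
  apply: le_trans (fatou P measurableT mh _) _.
    by move=> j w _; rewrite lee_fin sqr_ge0.
  apply: (@limn_einf_le _ _ N) => j Nj.
  rewrite (sqn_cls (L2B (F2 n) (F2 (k j)))) lee_fin clsB//.
  by apply: ne; apply: leq_trans Nj _; case: (kP j).
have FF2 : F \in L2.
  have [N NP] := FC 1 ltr01.
  have D2 : F_ N \- F \in L2.
    apply/L2P; split; first by apply: measurable_funB => //; exact: L2_measurable.
    apply: le_lt_trans (ltry 1); apply: (bound N 1 N) => m Nm.
    by apply/ltW/NP.
  have := L2B (F2 N) D2; rewrite (_ : F_ N \- (F_ N \- F) = F)//.
  by apply/funext => w /=; rewrite opprB addrCA subrr addr0.
exists F => //; apply/norm_cvgP => e e_gt0.
have e2 : 0 < e / 2 by rewrite divr_gt0.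
have [N NP] := FC _ e2; exists N => n Nn.
rewrite -clsB// -lte_fin -sqn_cls ?L2B//.
apply: (@le_lt_trans _ _ (e / 2)%:E); last by rewrite lte_fin; lra.
by apply: (bound n _ N) => m Nm; apply/ltW/NP.
Qed.

Lemma L2class_complete : norm_complete (L2inner P).
Proof.
move=> s sC; have sM : sub_sigma (@measurable _ Omega).
  by split=> //; exact: sigma_algebra_measurable.
have [||F [F2 _] sF] := @L2_complete _ (fun n => rep (s n)) sM.
- move=> n; split; first exact: rep_L2.
  move=> U mU; rewrite -[X in measurable X]setTI.
  exact: (L2_measurable (rep_L2 _)).
- by under eq_fun do rewrite cls_rep.
by exists (cls F); move: sF; under eq_fun do rewrite cls_rep.
Qed.

Lemma closed_L2_of G : sub_sigma G -> norm_closed (L2inner P) (L2_of P G).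
Proof.
move=> sG s l sP sl.
have /choice[F_ FP] n : exists F, (F \in L2 /\ meas_wrt G F) /\ cls F = s n.
  by have [F FG Fs] := sP n; exists F.
have sE : (fun n => cls (F_ n)) = s by apply/funext => n; case: (FP n).
have [|F FG] := @L2_complete G F_ sG (fun n => (FP n).1).
  by rewrite sE; exact: norm_cvg_cauchy sl.
by rewrite sE => sF; exists F => //; exact: norm_cvg_unique sF sl.
Qed.

End completeness.

(** * Conditional expectation as an orthogonal projection *)

Section conditional_expectation.
Context d (Omega : measurableType d) (R : realType) (P : probability Omega R).
Implicit Types (G : set (set Omega)) (F C : Omega -> R) (W : set Omega).
Local Notation L2 := (Lfun P 2%:E).
Local Notation cls := (cls P).
Local Notation ip := (L2inner P).

Lemma int_indic F W : F \in L2 -> measurable W ->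
  (\int[P]_(w in W) (F w)%:E = (ip (cls F) (cls \1_W))%:E)%E.
Proof.
move=> F2 mW; rewrite -L2ip_cls//; last exact: L2_indic.
rewrite unlock integral_mkcond; apply: eq_integral => w _.
by rewrite /patch /= indicE; case: ifP => _; rewrite ?mulr1 ?mulr0.
Qed.

Lemma sub_sigma_I G W W' : sub_sigma G -> G W -> G W' -> G (W `&` W').
Proof.
move=> [sG _] GW GW'; rewrite -(measurable_g_measurableTypeE sG).
by apply: measurableI; rewrite measurable_g_measurableTypeE.
Qed.

(** Integrate over the sets where [D >= 0] and where [D <= 0], which belong to
    the sigma-algebra: the integral of [`|D|] vanishes. *)
Lemma meas_wrt_zero G (D : Omega -> R) : sub_sigma G -> meas_wrt G D ->
  (forall B, G B -> (\int[P]_(w in B) (D w)%:E = 0)%E) -> D = cst 0 %[ae P].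
Proof.
move=> sG GD D0; have [_ Gm] := sG; have mD := meas_wrt_measurable sG GD.
pose B1 := D @^-1` `[0, +oo[%classic; pose B2 := D @^-1` `]-oo, 0]%classic.
have GB1 : G B1 by exact: GD.
have GB2 : G B2 by exact: GD.
have mDB B : measurable_fun B (fun w => (D w)%:E).
  by apply/measurable_EFinP; exact: measurable_funS mD.
have h1 : ae_eq P B1 (fun w => (D w)%:E) (cst 0%E).
  apply/ae_eq_integral_abs => //; first exact: Gm.
  rewrite -[RHS](D0 _ GB1); apply: eq_integral => w; rewrite inE /B1/= in_itv/=.
  by rewrite andbT => Dw; rewrite ger0_norm.
have h2 : ae_eq P B2 (fun w => (D w)%:E) (cst 0%E).
  apply/ae_eq_integral_abs => //; first exact: Gm.
  have := D0 _ GB2.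
  rewrite [X in X = _ -> _](eq_integral (fun w => - `|(D w)%:E|)%E); last first.
    move=> w; rewrite inE /B2/= in_itv/= => Dw.
    by rewrite /= ler0_norm// opprK.
  by rewrite integral_ge0N// => /eqP; rewrite oppe_eq0 => /eqP.
apply: filterS2 h1 h2 => w /= h1 h2 _.
case: (leP 0 (D w)) => Dw.
  by have := h1; rewrite /B1/= in_itv/= Dw => /(_ isT)[].
by have := h2; rewrite /B2/= in_itv/= (ltW Dw) => /(_ isT)[].
Qed.

Lemma L2_of_zero G u : sub_sigma G -> L2_of P G u ->
  (forall W, G W -> ip u (cls \1_W) = 0) -> u = 0.
Proof.
move=> sG [D [D2 GD] <-] D0; rewrite -cls_cst0; apply/cls_eq => //.
  exact: L2_cst.
apply: meas_wrt_zero GD _ => // B GB; rewrite int_indic// ?D0//.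
by case: sG => _; exact.
Qed.

Lemma L2_ae F C : F \in L2 -> measurable_fun setT C -> C = F %[ae P] -> C \in L2.
Proof.
move=> F2 mC CF; apply/L2P; split=> //; have [mF] := (L2P _ _).1 F2.
rewrite (@ae_eq_integral _ _ _ P setT (fun w => (C w ^+ 2)%:E))//.
- by apply/measurable_EFinP; exact: measurable_funX.
- by apply/measurable_EFinP; exact: measurable_funX.
- by apply: filterS CF => w /= /(_ I) -> _.
Qed.

Lemma L2_of_indic G W : sub_sigma G -> G W -> L2_of P G (cls \1_W).
Proof.
move=> sG GW; exists \1_W => //; split.
  by apply: L2_indic; case: sG => _; exact.
apply/meas_wrtP => //; apply: measurable_indic.
by rewrite /measurable/= sigma_algebra_id//; case: sG.
Qed.

(** The projection of [F] has the integrals of [F] over the sets of [G], hence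
    is a conditional expectation, and any two versions agree almost surely by
    [meas_wrt_zero]. So the version chosen by [condexp] is square integrable and
    represents the projection. *)
Lemma condexpP G F : sub_sigma G -> F \in L2 ->
  [/\ condexp P G F \in L2, meas_wrt G (condexp P G F) &
      is_orthoproj ip (L2_of P G) (cls F) (cls (condexp P G F))].
Proof.
move=> sG F2; have [_ Gm] := sG.
have [_ [[C0 [C02 GC0] <-] pr0]] := proj_exists (cls F) (@L2class_complete _ _ _ P)
  (linspace_L2_of P sG) (closed_L2_of sG).
have C0int B : G B -> (\int[P]_(w in B) (C0 w)%:E = \int[P]_(w in B) (F w)%:E)%E.
  move=> GB; have mB := Gm _ GB; rewrite !int_indic//; congr EFin.
  by apply/esym/eqP; rewrite -subr_eq0 -ipBl pr0//; exact: L2_of_indic.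
have [GC iC Cint] : is_condexp P G F (condexp P G F).
  apply: (@xgetI _ (cst 0) [set C | is_condexp P G F C] C0).
  by split => //; exact: L2_integrable.
set C := condexp P G F in GC iC Cint *.
have mC := meas_wrt_measurable sG GC.
have CC0 : C = C0 %[ae P].
  suff : C \- C0 = cst 0 %[ae P].
    by apply: filterS => w /= /(_ I) /eqP; rewrite subr_eq0 => /eqP.
  apply: (meas_wrt_zero sG).
    by apply/meas_wrtP => //; apply: measurable_funB; exact/meas_wrtP.
  move=> B GB; have mB := Gm _ GB.
  rewrite (eq_integral (fun w => (C w)%:E - (C0 w)%:E)%E)//.
  rewrite integralB//.
  - rewrite Cint// C0int// subee// int_indic//.
  - exact: integrableS iC.
  - by apply: integrableS (L2_integrable C02).
have C2 := L2_ae C02 mC CC0.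
split => //; rewrite (cls_eq C2 C02).2//.
by split => //; exists C0.
Qed.

Definition condexp_cls G (u : L2class P) : L2class P := cls (condexp P G (rep u)).

Lemma condexp_cls_proj G u : sub_sigma G ->
  is_orthoproj ip (L2_of P G) u (condexp_cls G u).
Proof.
move=> sG; have [_ _] := condexpP sG (rep_L2 u).
by rewrite cls_rep.
Qed.

Lemma cls_condexp G F : sub_sigma G -> F \in L2 ->
  cls (condexp P G F) = condexp_cls G (cls F).
Proof.
move=> sG F2; have [_ _ pr] := condexpP sG F2.
exact: (proj_unique (linspace_L2_of P sG) pr (condexp_cls_proj _ sG)).
Qed.

(** If [u = p + q] with [p] the projection of [u] on the part of [K] inside
    [L2_of P <<s S>>], then [q] has zero integral over every set of [S], hence
    over every set of the generated sigma-algebra by Dynkin's theorem. *)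
Lemma L2_of_dense (S : set (set Omega)) (K : set (L2class P)) :
  S `<=` measurable -> setI_closed S -> S setT ->
  linspace K -> norm_closed ip K -> (forall W, S W -> K (cls \1_W)) ->
  L2_of P <<s S >> `<=` K.
Proof.
move=> Sm SI ST Ks Kc SK u Gu.
have sG : sub_sigma <<s S >>.
  split; first exact: smallest_sigma_algebra.
  by apply: smallest_sub => //; exact: sigma_algebra_measurable.
(* Projecting on [K] alone could leave [L2_of P <<s S >>]. *)
pose K' := K `&` L2_of P <<s S >>.
have [G0 GP] := linspace_L2_of P sG.
have K's : linspace K'.
  case: Ks => K0 KP; split=> // c v w [Kv Gv] [Kw Gw].
  by split; [exact: KP|exact: GP].
have K'c : norm_closed ip K'.
  move=> s l sP sl; split; first by apply: Kc sl => n; case: (sP n).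
  by apply: (closed_L2_of sG) sl => n; case: (sP n).
have [p [[Kp Gp] pP]] := proj_exists u (@L2class_complete _ _ _ P) K's K'c.
suff q0 : u - p = 0 by rewrite -(subrK p u) q0 add0r.
apply: (L2_of_zero sG).
  by apply: linspaceB => //; exact: linspace_L2_of.
have iq := L2_integrable (rep_L2 (u - p)).
pose Z := [set W | measurable W /\ ip (u - p) (cls \1_W) = 0].
have ZE W : measurable W ->
    (\int[P]_(w in W) (rep (u - p) w)%:E = (ip (u - p) (cls \1_W))%:E)%E.
  by move=> mW; rewrite int_indic ?rep_L2// cls_rep.
suff : <<s S >> `<=` Z by move=> GZ W /GZ[].
rewrite -setI_closed_g_dynkin_g_sigma_algebra//; apply: smallest_sub; last first.
  move=> W SW; split; first exact: Sm.
  apply: pP; split; first exact: SK.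
  by apply: L2_of_indic => //; exact: sub_sigma_algebra.
have ZT : Z setT.
  split => //; apply: pP; split; first exact: SK.
  by apply: L2_of_indic => //; exact: sub_sigma_algebra.
split => //.
  move=> W [mW W0]; split; first exact: measurableC.
  have -> : cls \1_(~` W) = cls \1_setT - cls \1_W.
    rewrite -clsB ?L2_indic//; congr cls; apply/funext => w /=.
    by rewrite !indicE in_setC in_setT; case: (w \in W); rewrite ?subrr ?subr0.
  by rewrite ipBr ZT.2 W0 subrr.
move=> B tB BZ; have mB i : measurable (B i) by case: (BZ i).
have mU : measurable (\bigcup_i B i) by exact: bigcup_measurable.
split => //; apply: EFin_inj; rewrite -ZE// integral_bigcup//; last first.
  by apply: integrableS iq.
by rewrite eseries0// => i _ _; rewrite ZE//; case: (BZ i) => _ ->.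
Qed.

End conditional_expectation.

(** * The Doob-Dynkin lemma *)

Section doob_dynkin.
Context d d' (Omega : measurableType d) (Y : measurableType d') (R : realType).

(** [F] is recovered from its sublevel sets: [F w] is the infimum of the
    rationals [q] with [F w < q], and each [F @^-1` ]-oo, q[ ] is pulled back
    from a measurable set [V q] of [Y]. *)
Lemma doob_dynkin (T : Omega -> Y) (F : Omega -> R) :
  (forall U : set R, measurable U ->
     preimage_set_system setT T measurable (F @^-1` U)) ->
  exists2 f : Y -> R, measurable_fun setT f & F = f \o T.
Proof.
move=> FT.
have /choice[V VP] (q : rat) : exists V, measurable V /\
    F @^-1` `]-oo, ratr q[%classic = T @^-1` V.
  have [V mV VE] := FT _ (measurable_itv `]-oo, ratr q[).
  by exists V; rewrite -VE setTI.
have VE q w : (F w < ratr q) = (T w \in V q).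
  have := congr1 (fun W => W w) (VP q).2; rewrite /preimage/= in_itv/= => Vq.
  by apply/idP/idP; rewrite inE -Vq.
pose g n y : \bar R := if (choice.unpickle n : option rat) is Some q then
  if y \in V q then (ratr q)%:E else +oo%E else +oo%E.
have mg n : measurable_fun setT (g n).
  rewrite /g; case: (choice.unpickle n) => [q|]; last exact: measurable_cst.
  apply: measurable_fun_ifT; first last.
  - exact: measurable_cst.
  - exact: measurable_cst.
  apply: (measurable_fun_bool true).
  rewrite setTI (_ : _ @^-1` _ = V q); first by case: (VP q).
  by apply/seteqP; split=> y /=; [move=> /set_mem|move=> /mem_set].
exists (fun y => fine (einfs (g ^~ y) 0)).
  apply: measurableT_comp; first exact: fine_measurable.
  exact: measurable_fun_einfs.
apply/funext => w /=.
suff -> : einfs (g ^~ (T w)) 0 = (F w)%:E by [].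
apply/eqP; rewrite eq_le; apply/andP; split.
  apply/lee_addgt0Pr => e e0; rewrite -EFinD.
  have /rat_in_itvoo[q] : F w < F w + e by rewrite ltrDl.
  rewrite in_itv/= => /andP[Fq qF].
  apply: (@le_trans _ _ (ratr q)%:E); last by rewrite lee_fin ltW.
  apply: ereal_inf_lbound; exists (choice.pickle q) => //=.
  by rewrite /g choice.pickleK -VE Fq.
apply/ereal_infP => _ [n _ <-]; rewrite /g.
case: (choice.unpickle n) => [q|]; last exact: leey.
by rewrite -VE; case: ltP => Fq; [rewrite lee_fin ltW|exact: leey].
Qed.

End doob_dynkin.

(** * Conditional independence *)

Section independence.
Context d (Omega : measurableType d) (R : realType) (P : probability Omega R).
Context (A : countType) (E0 : ptopologicalType) (E : A -> ptopologicalType).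
Context (Z : {RV P >-> borel E0}) (X : forall a, {RV P >-> borel (E a)}).
Implicit Types (B C : set A) (a b : A).
Local Notation L2 := (Lfun P 2%:E).
Local Notation cls := (cls P).
Local Notation ip := (L2inner P).
Local Notation sigmaG := (sigmaG Z X).
Local Notation sigmaZ := (sigmaZ Z).

Lemma sub_sigma_sigmaZ : sub_sigma sigmaZ.
Proof.
split; first exact/sigma_algebra_preimage/sigma_algebra_measurable.
by move=> _ [U mU <-]; exact: measurable_funP.
Qed.

Lemma sub_sigma_sigmaG B : sub_sigma (sigmaG B).
Proof.
split; first exact: smallest_sigma_algebra.
apply: smallest_sub; first exact: sigma_algebra_measurable.
move=> W [[b _ [U mU <-]]|]; first exact: measurable_funP.
by case: sub_sigma_sigmaZ => _; exact.
Qed.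

Lemma sigmaZ_sub B : sigmaZ `<=` sigmaG B.
Proof. by move=> W ZW; apply: sub_sigma_algebra; right. Qed.

Lemma sigmaG_X B a (U : set (borel (E a))) : ~ B a -> measurable U ->
  sigmaG B (X a @^-1` U).
Proof.
move=> Ba mU; apply: sub_sigma_algebra; left; exists a => //.
by exists U; rewrite ?setTI.
Qed.

Lemma sigmaG_sub B (G : set (set Omega)) : sigma_algebra setT G ->
  sigmaZ `<=` G ->
  (forall b (U : set (borel (E b))), ~ B b -> measurable U -> G (X b @^-1` U)) ->
  sigmaG B `<=` G.
Proof.
move=> sG ZG XG; apply: smallest_sub => // W [[b Bb [U mU <-]]|]; last exact: ZG.
by rewrite setTI; exact: XG.
Qed.

Lemma sigmaG_anti B C : B `<=` C -> sigmaG C `<=` sigmaG B.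
Proof.
move=> BC; apply: sigmaG_sub; last 2 first.
- exact: sigmaZ_sub.
- by move=> b U Cb mU; apply: sigmaG_X => // /BC.
- by case: (sub_sigma_sigmaG B).
Qed.

Lemma sigmaG_setT : sigmaG setT = sigmaZ.
Proof.
apply/seteqP; split; last exact: sigmaZ_sub.
by apply: sigmaG_sub => [||b U /(_ I)//] //; case: sub_sigma_sigmaZ.
Qed.

Lemma linspace_G B : linspace (L2_of P (sigmaG B)).
Proof. exact/linspace_L2_of/sub_sigma_sigmaG. Qed.

Lemma closed_G B : norm_closed ip (L2_of P (sigmaG B)).
Proof. exact/closed_L2_of/sub_sigma_sigmaG. Qed.

Lemma L2_of_anti B C : B `<=` C -> L2_of P (sigmaG C) `<=` L2_of P (sigmaG B).
Proof. by move=> BC; apply: L2_of_mono; exact: sigmaG_anti. Qed.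

Definition projG a := condexp_cls (P := P) (sigmaG [set a]).

Lemma projG_proj a u : is_orthoproj ip (L2_of P (sigmaG [set a])) u (projG a u).
Proof. exact/condexp_cls_proj/sub_sigma_sigmaG. Qed.

Hypothesis X_indep : cond_independent Z X.

(** Given [Z] and the [X b], [b] outside [C] and [b <> a], the law of [X a]
    depends on [Z] only. So [projG a] replaces the factor [1_U (X a)] of
    [1_U (X a) * 1_W], [W] in [sigmaG (C `|` [set a])], by
    [P (X a \in U | Z)]; products of this form generate [sigmaG C]. *)
Lemma projG_forgets C a u : L2_of P (sigmaG C) u ->
  L2_of P (sigmaG (C `|` [set a])) (projG a u).
Proof.
set N := sigmaG (C `|` [set a]) => Cu.
have sN : sub_sigma N by exact: sub_sigma_sigmaG.
have [sigN mN] := sN.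
have sa : sub_sigma (sigmaG [set a]) by exact: sub_sigma_sigmaG.
have Na : N `<=` sigmaG [set a] by apply: sigmaG_anti => b; right.
have Prl : is_linear (projG a).
  by exact: (proj_lin (linspace_G _) (projG_proj a)).
pose S := [set W | exists (U : set (borel (E a))) W',
  [/\ measurable U, N W' & W = X a @^-1` U `&` W']].
have NT : N setT.
  by rewrite -(measurable_g_measurableTypeE sigN); exact: measurableT.
have SN : N `<=` S.
  by move=> W NW; exists setT, W; split => //; rewrite preimage_setT setTI.
have CS : sigmaG C `<=` <<s S >>.
  apply: sigmaG_sub; first exact: smallest_sigma_algebra.
    by move=> W ZW; apply: sub_sigma_algebra; apply: SN; exact: sigmaZ_sub.
  move=> b U Cb mU; apply: sub_sigma_algebra.
  case: (pselect (b = a)) => ba; last by apply: SN; apply: sigmaG_X => // -[].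
  by move: U mU; rewrite ba => U mU; exists U, setT; split => //; rewrite setIT.
pose K := [set v | L2_of P N (projG a v)].
suff : L2_of P <<s S >> `<=` K by apply; exact: (L2_of_mono CS Cu).
apply: L2_of_dense.
- move=> _ [U [W [mU NW ->]]]; apply: measurableI; last exact: mN.
  by rewrite -[X in measurable X]setTI; exact: measurable_funP.
- move=> _ _ [U [W [mU NW ->]]] [U' [W' [mU' NW' ->]]].
  exists (U `&` U'), (W `&` W'); split; first exact: measurableI.
    exact: (sub_sigma_I sN).
  by rewrite preimage_setI setIACA.
- exact: SN.
- split; first by rewrite /K/= (lin0 Prl); case: (linspace_G (C `|` [set a])).
  move=> c v w Kv Kw; rewrite /K/= Prl.
  by have [_ NP] := linspace_G (C `|` [set a]); exact: NP.
- move=> s l sK sl; apply: (@closed_G _ (fun n => projG a (s n))) => //.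
  exact: (norm_cvg_proj (linspace_G _) (projG_proj a)).
- move=> _ [U [W [mU NW ->]]].
  have mUW : measurable (X a @^-1` U).
    by rewrite -[X in measurable X]setTI; exact: measurable_funP.
  have mW := mN _ NW; pose F : Omega -> R := \1_(X a @^-1` U).
  have F2 : F \in L2 by exact: L2_indic.
  have [C02 _ [_ C0orth]] := condexpP sa F2.
  have [C12 C1Z _] := condexpP sub_sigma_sigmaZ F2.
  set C0 := condexp P _ F in C02 C0orth; set C1 := condexp P sigmaZ F in C12 C1Z.
  have C01 : cls C0 = cls C1 by apply/(cls_eq C02 C12); exact: X_indep.
  have WC1 : meas_wrt N (\1_W \* C1).
    apply/meas_wrtP => //; apply: measurable_funM.
      by apply: measurable_indic; rewrite measurable_g_measurableTypeE.
    by apply/meas_wrtP => // V mV; apply: sigmaZ_sub; exact: C1Z.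
  have WC12 : \1_W \* C1 \in L2 by exact: L2_indicM.
  rewrite /K/=.
  suff -> : projG a (cls \1_(X a @^-1` U `&` W)) = cls (\1_W \* C1).
    by exists (\1_W \* C1); [split|].
  apply: (proj_unique (linspace_G _) (projG_proj a _)); split.
    by exists (\1_W \* C1) => //; split => // V mV; apply: Na; exact: WC1.
  move=> _ [k [k2 Gk] <-].
  have WK : L2_of P (sigmaG [set a]) (cls (\1_W \* k)).
    exists (\1_W \* k) => //; split; first exact: L2_indicM.
    apply/meas_wrtP => //; apply: measurable_funM; last exact/meas_wrtP.
    apply: measurable_indic; rewrite measurable_g_measurableTypeE; first exact: Na.
    by case: sa.
  rewrite -[RHS](C0orth _ WK) C01 !ipBl; congr (_ - _).
    apply: EFin_inj.
    rewrite -!L2ip_cls ?L2_indic ?L2_indicM//; last exact: measurableI.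
    congr expectation; apply/funext => w /=; rewrite /F indicI/=.
    by rewrite mulrA.
  apply: EFin_inj; rewrite -!L2ip_cls ?L2_indicM//.
  by congr expectation; apply/funext => w /=; ring.
Qed.

Lemma projG_stable C a u : L2_of P (sigmaG C) u -> L2_of P (sigmaG C) (projG a u).
Proof. by move/(projG_forgets a); apply: L2_of_anti => b; left. Qed.

(** Both products are the projection on [L2_of (sigmaG [set a; b])]. *)
Lemma projG_comm a b u : projG a (projG b u) = projG b (projG a u).
Proof.
have both a' b' : is_orthoproj ip (L2_of P (sigmaG ([set b'] `|` [set a']))) u
    (projG a' (projG b' u)).
  split; first by apply: projG_forgets; case: (projG_proj b' u).
  move=> k kG.
  have [[_ pb] [_ pa]] := (projG_proj b' u, projG_proj a' (projG b' u)).
  have kb : L2_of P (sigmaG [set b']) k by apply: L2_of_anti kG => c; left.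
  have ka : L2_of P (sigmaG [set a']) k by apply: L2_of_anti kG => c; right.
  by have := pb _ kb; have := pa _ ka; rewrite !ipBl; lra.
apply: (proj_unique (linspace_G _) (both a b)).
by rewrite setUC; exact: both.
Qed.

(** Being fixed by [projG a] means not depending on [X a]. *)
Lemma fixed_L2_of C (s : seq A) u : L2_of P (sigmaG C) u ->
  (forall a, a \in s -> projG a u = u) -> L2_of P (sigmaG (C `|` [set` s])) u.
Proof.
move=> Cu; elim: s => [_|a s IH sP]; first by rewrite set_nil setU0.
rewrite (_ : [set` a :: s] = [set` s] `|` [set a]); last first.
  by apply/seteqP; split=> b /=; rewrite inE; [move=> /predU1P[->|]; [right|left]
    |move=> [->|->]; rewrite ?orbT ?eqxx].
rewrite setUA -(sP a) ?mem_head//.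
by apply: projG_forgets; apply: IH => b bs; apply: sP; rewrite inE bs orbT.
Qed.

End independence.

(** * Functionals of X and Z *)

Section functionals.
Context d (Omega : measurableType d) (R : realType) (P : probability Omega R).
Context (A : countType) (E0 : ptopologicalType) (E : A -> ptopologicalType).
Context (Z : {RV P >-> borel E0}) (X : forall a, {RV P >-> borel (E a)}).
Local Notation L2 := (Lfun P 2%:E).

(** The sigma-algebra [sigmaG set0] is the one generated by the pair (X, Z). *)
Lemma L2_functionalP F : L2_functional Z X F <->
  F \in L2 /\ meas_wrt (sigmaG Z X set0) F.
Proof.
pose T w : g_sigma_algebraType (@E_A_cylinders A E) * borel E0 :=
  ((fun a => X a w), Z w).
have sG := sub_sigma_sigmaG Z X set0; have [sigG _] := sG.
split=> -[F2 FP]; split => //.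
  case: FP => f mf ->.
  have mT : measurable_fun [set: g_sigma_algebraType (sigmaG Z X set0)] T.
    apply: measurable_fun_pair.
      apply: (@measurability _ _ (g_sigma_algebraType (sigmaG Z X set0))
        (g_sigma_algebraType (@E_A_cylinders A E)) _ _ _ erefl).
      move=> _ [_ [a _ [U mU <-]] <-].
      rewrite measurable_g_measurableTypeE//.
      by rewrite !setTI; exact: (@sigmaG_X _ _ _ _ _ _ _ Z X).
    move=> _ U mU; rewrite measurable_g_measurableTypeE//.
    by apply: sigmaZ_sub; exists U.
  by apply/meas_wrtP => //; exact: (measurableT_comp mf mT).
have [U mU|f mf FT] := @doob_dynkin _ _ _ _ _ T F; last by exists f.
have sub : sigmaG Z X set0 `<=` preimage_set_system setT T measurable.
  apply: sigmaG_sub.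
  - exact/sigma_algebra_preimage/sigma_algebra_measurable.
  - move=> _ [V mV <-]; exists (snd @^-1` V) => //.
    by rewrite -[X in measurable X]setTI; exact: measurable_snd.
  - move=> b V _ mV; exists (fst @^-1` [set x : @E_A A E | V (x b)]).
      rewrite -[X in measurable X]setTI; apply: measurable_fst => //.
      apply: sub_sigma_algebra; exists b => //; exists V => //.
      by rewrite setTI.
    by rewrite setTI.
by apply: sub; exact: FP.
Qed.

End functionals.

Section chaos_functionals.
Context d (Omega : measurableType d) (R : realType) (P : probability Omega R).
Context (A : countType) (E0 : ptopologicalType) (E : A -> ptopologicalType).
Context (Z : {RV P >-> borel E0}) (X : forall a, {RV P >-> borel (E a)}).
Context (Am : nat -> {fset A}).
Hypothesis X_indep : cond_independent Z X.
Hypothesis Am_incr : forall m : nat, (Am m `<=` Am m.+1)%fset.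
Hypothesis Am_cover : forall a : A, exists m : nat, a \in Am m.
Implicit Types (F G : Omega -> R) (n m k : nat) (a : A).
Local Notation L2 := (Lfun P 2%:E).
Local Notation cls := (cls P).
Local Notation ip := (L2inner P).
Local Notation sigmaG := (sigmaG Z X).
Local Notation sigmaZ := (sigmaZ Z).
Local Notation projG := (projG Z X).
Local Notation H := (L2_of P (sigmaG set0)).
Local Notation pi_fin := (pi_fin Z X).
Local Notation chaos_proj := (chaos_proj Z X Am).

Lemma cls_comps (T : A -> (Omega -> R) -> Omega -> R)
    (T' : A -> L2class P -> L2class P) (r : seq A) F :
  (forall a G, G \in L2 -> T a G \in L2 /\ cls (T a G) = T' a (cls G)) ->
  F \in L2 -> (\big[comp/id]_(a <- r) T a) F \in L2 /\
    cls ((\big[comp/id]_(a <- r) T a) F) = (\big[comp/id]_(a <- r) T' a) (cls F).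
Proof.
move=> TT' F2; elim: r => [|a r [IH2 IH]]; first by rewrite !big_nil.
by rewrite !big_cons /=; have [? ->] := TT' a _ IH2; rewrite IH.
Qed.

Lemma cls_condexpG a F : F \in L2 ->
  condexpG Z X a F \in L2 /\ cls (condexpG Z X a F) = projG a (cls F).
Proof.
move=> F2; have sa := sub_sigma_sigmaG Z X [set a].
by split; [case: (condexpP sa F2)|exact: cls_condexp].
Qed.

Lemma cls_gradient a F : F \in L2 ->
  gradient Z X a F \in L2 /\ cls (gradient Z X a F) = grad projG a (cls F).
Proof.
move=> F2; have [C2 CE] := cls_condexpG a F2.
by split; [exact: L2B|rewrite /gradient (clsB F2 C2) CE].
Qed.

Lemma cls_pi_fin S n F : F \in L2 ->
  pi_fin S n F \in L2 /\ cls (pi_fin S n F) = chaos projG S n (cls F).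
Proof.
move=> F2.
have term (J : {fset A}) : #|` J| == n ->
    (\big[comp/id]_(b <- J) gradient Z X b)
      ((\big[comp/id]_(c <- (S `\` J)%fset) condexpG Z X c) F) \in L2 /\
    cls ((\big[comp/id]_(b <- J) gradient Z X b)
      ((\big[comp/id]_(c <- (S `\` J)%fset) condexpG Z X c) F)) =
    (\big[comp/id]_(b <- J) grad projG b)
      ((\big[comp/id]_(c <- (S `\` J)%fset) projG c) (cls F)).
  move=> _; have [C2 CE] := cls_comps (enum_fset (S `\` J)%fset) cls_condexpG F2.
  by have [G2 GE] := cls_comps (enum_fset J) cls_gradient C2; rewrite GE CE.
have [S2 SE] := L2_sum (fpowerset S) (fun J Jn => (term J Jn).1).
split => //; rewrite [LHS]SE; apply: eq_bigr => J Jn.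
by have [] := term J Jn.
Qed.

Lemma cls_L2_functional F : L2_functional Z X F -> F \in L2 /\ H (cls F).
Proof. by move=> /L2_functionalP[F2 GF]; split => //; exists F. Qed.

Let Hs : linspace H := linspace_G Z X set0.
Let Hc : norm_closed ip H := @closed_G _ _ _ _ _ _ _ Z X set0.
Let Ms a : linspace (L2_of P (sigmaG [set a])) := linspace_G Z X [set a].
Let PM a u := projG_proj Z X a u :
  is_orthoproj ip (L2_of P (sigmaG [set a])) u (projG a u).
Let HP a u : H u -> H (projG a u). Proof. exact: projG_stable. Qed.
Let PC a b u : projG a (projG b u) = projG b (projG a u).
Proof. exact: projG_comm. Qed.
Let Vc := @L2class_complete _ _ _ P.

Let Am_mono m k : (m <= k)%N -> (Am m `<=` Am k)%fset.
Proof.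
move=> mk; rewrite -(subnK mk); elim: (k - m)%N => [|i IH]; first by rewrite add0n.
by rewrite addSn; exact: fsubset_trans IH (Am_incr _).
Qed.

(** The functionals of [Z] and of the finitely many [X b], [b] in [Am k]. *)
Let Hm k : set (L2class P) := L2_of P (sigmaG (~` [set` Am k])).

Let Hms k : linspace (Hm k) := linspace_G Z X _.

Let HmH k : Hm k `<=` H. Proof. exact: L2_of_anti. Qed.

Let HmP k a u : Hm k u -> Hm k (projG a u). Proof. exact: projG_stable. Qed.

Let Hm_id k a u : a \notin Am k -> Hm k u -> projG a u = u.
Proof.
move=> ak Hu; apply: (proj_fix (Ms a) (PM a)); apply: L2_of_anti Hu.
by move=> b ->; exact/negP.
Qed.

Let Hm0 k u : Hm k u -> (forall a, a \in Am k -> projG a u = u) ->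
  L2_of P sigmaZ u.
Proof.
move=> Hu Pu; rewrite -(sigmaG_setT Z X) -(setvU [set` Am k]).
exact: (fixed_L2_of X_indep (s := Am k)).
Qed.

Let Hm_dense K : linspace K -> norm_closed ip K ->
  (forall k, Hm k `<=` K) -> H `<=` K.
Proof.
move=> Ks Kc HK; pose S := \bigcup_k sigmaG (~` [set` Am k]).
have mS k k' : (k <= k')%N ->
    sigmaG (~` [set` Am k]) `<=` sigmaG (~` [set` Am k']).
  move=> kk'; apply: sigmaG_anti; apply: subsetC => a.
  exact: (fsubsetP (Am_mono kk')).
have sk k := sub_sigma_sigmaG Z X (~` [set` Am k]).
have HS : sigmaG set0 `<=` <<s S>>.
  apply: sigmaG_sub; first exact: smallest_sigma_algebra.
    by move=> W ZW; apply: sub_sigma_algebra; exists 0%N => //; exact: sigmaZ_sub.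
  move=> b U _ mU; apply: sub_sigma_algebra; have [k bk] := Am_cover b.
  by exists k => //; apply: sigmaG_X => // /(_ bk).
apply: subset_trans (L2_of_mono HS) _; apply: L2_of_dense => //.
- by move=> W [k _]; case: (sk k) => _; exact.
- move=> W W' [k _ Wk] [k' _ Wk']; exists (maxn k k') => //.
  apply: (sub_sigma_I (sk _)); [apply: mS Wk|apply: mS Wk'].
    exact: leq_maxl.
  exact: leq_maxr.
- exists 0%N => //; have [sG _] := sk 0%N.
  by rewrite -(measurable_g_measurableTypeE sG); exact: measurableT.
- by move=> W [k _ Wk]; apply: (HK k); exact: L2_of_indic.
Qed.

Let Q := condexp_cls (P := P) sigmaZ.
Let M0s := linspace_L2_of P (sub_sigma_sigmaZ Z).
Let QM (u : L2class P) := condexp_cls_proj u (sub_sigma_sigmaZ Z).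
Let M0M a : L2_of P sigmaZ `<=` L2_of P (sigmaG [set a]).
Proof. apply: L2_of_mono; exact: sigmaZ_sub. Qed.

Lemma chaos_proj_cvg n F : L2_functional Z X F ->
  L2_functional Z X (chaos_proj n F) /\
  L2_cvg P (fun m => pi_fin (Am m) n F) (chaos_proj n F).
Proof.
move=> /cls_L2_functional[F2 HF].
have [l cl] := chaos_cvg Vc Ms PM Hs Hc HP PC Am_mono Hms HmH HmP Hm_id
  Hm_dense n HF.
have [G [G2 GG] Gl] : H l.
  by apply: Hc cl => m; exact: (chaos_stable Ms PM Hs HP PC).
apply: (@xgetI _ (cst 0) [set G | L2_functional Z X G /\
  L2_cvg P (fun m => pi_fin (Am m) n F) G] G); split; first exact/L2_functionalP.
apply/L2_cvg_cls => // [m|]; first by case: (cls_pi_fin (Am m) n F2).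
by rewrite Gl; under eq_fun do rewrite (cls_pi_fin _ _ F2).2.
Qed.

Definition limit_proj n (u : L2class P) : L2class P :=
  xget 0 [set l | norm_cvg ip (fun m => chaos projG (Am m) n u) l].

Lemma limit_projP n u : H u ->
  norm_cvg ip (fun m => chaos projG (Am m) n u) (limit_proj n u).
Proof.
move=> Hu.
have [l cl] := chaos_cvg Vc Ms PM Hs Hc HP PC Am_mono Hms HmH HmP Hm_id
  Hm_dense n Hu.
exact: (@xgetI _ 0 [set l | norm_cvg ip (fun m => chaos projG (Am m) n u) l] l).
Qed.

Lemma cls_chaos_proj n F : L2_functional Z X F ->
  cls (chaos_proj n F) = limit_proj n (cls F).
Proof.
move=> HF; have [/cls_L2_functional[C2 _] cvC] := chaos_proj_cvg n HF.
have [F2 HcF] := cls_L2_functional HF.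
have pi2 m : pi_fin (Am m) n F \in L2 by case: (cls_pi_fin (Am m) n F2).
apply: norm_cvg_unique (limit_projP n HcF).
have := (L2_cvg_cls pi2 C2).1 cvC.
by under eq_fun do rewrite (cls_pi_fin _ _ F2).2.
Qed.

Lemma L2_functional_lin c F G : L2_functional Z X F -> L2_functional Z X G ->
  L2_functional Z X (fun w => c * F w + G w).
Proof.
move=> /L2_functionalP[F2 FG] /L2_functionalP[G2 GG]; apply/L2_functionalP.
have sG := sub_sigma_sigmaG Z X set0; split; first exact: L2_lin.
move: FG GG => /(meas_wrtP _ sG) FG /(meas_wrtP _ sG) GG; apply/meas_wrtP => //.
by apply: measurable_funD => //; exact: measurable_funM.
Qed.

Lemma chaos_proj_functional n F : L2_functional Z X F ->
  L2_functional Z X (chaos_proj n F).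
Proof. by move=> HF; case: (chaos_proj_cvg n HF). Qed.

Lemma chaos_proj_projector n :
  orthogonal_projector P (L2_functional Z X) (chaos_proj n).
Proof.
split=> [F|F G HF HG FG|c F G HF HG|F HF|F G HF HG].
- exact: chaos_proj_functional.
- have [F2 _] := cls_L2_functional HF; have [G2 _] := cls_L2_functional HG.
  have [CF2 _] := cls_L2_functional (chaos_proj_functional n HF).
  have [CG2 _] := cls_L2_functional (chaos_proj_functional n HG).
  apply/(cls_eq CF2 CG2).
  by rewrite (cls_chaos_proj n HF) (cls_chaos_proj n HG) ((cls_eq F2 G2).2 FG).
- have HFG := L2_functional_lin c HF HG.
  have [F2 HcF] := cls_L2_functional HF; have [G2 HcG] := cls_L2_functional HG.
  have [CF2 _] := cls_L2_functional (chaos_proj_functional n HF).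
  have [CG2 _] := cls_L2_functional (chaos_proj_functional n HG).
  have [CFG2 _] := cls_L2_functional (chaos_proj_functional n HFG).
  apply/(cls_eq CFG2 (L2_lin _ CF2 CG2)).
  rewrite (cls_lin _ CF2 CG2) (cls_chaos_proj n HFG) (cls_chaos_proj n HF).
  rewrite (cls_chaos_proj n HG) (cls_lin _ F2 G2).
  exact: (limit_lin Ms PM Hs limit_projP).
- have HC := chaos_proj_functional n HF; have HCC := chaos_proj_functional n HC.
  have [F2 HcF] := cls_L2_functional HF.
  apply/(cls_eq (cls_L2_functional HCC).1 (cls_L2_functional HC).1).
  rewrite (cls_chaos_proj n HC) (cls_chaos_proj n HF).
  exact: (limit_idem Ms PM Hs Hc HP PC limit_projP).
- have [F2 HcF] := cls_L2_functional HF; have [G2 HcG] := cls_L2_functional HG.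
  have [CF2 _] := cls_L2_functional (chaos_proj_functional n HF).
  have [CG2 _] := cls_L2_functional (chaos_proj_functional n HG).
  rewrite (L2ip_cls CF2 G2) (L2ip_cls F2 CG2); congr EFin.
  rewrite (cls_chaos_proj n HF) (cls_chaos_proj n HG).
  exact: (limit_selfadj Ms PM Hs HP PC limit_projP).
Qed.

Lemma chaos_proj_orthogonal n k : n <> k ->
  orthogonal_ranges P (L2_functional Z X) (chaos_proj n) (chaos_proj k).
Proof.
move=> nk F G HF HG.
have [F2 HcF] := cls_L2_functional HF; have [G2 HcG] := cls_L2_functional HG.
have [CF2 _] := cls_L2_functional (chaos_proj_functional n HF).
have [CG2 _] := cls_L2_functional (chaos_proj_functional k HG).
rewrite (L2ip_cls CF2 CG2) (cls_chaos_proj n HF) (cls_chaos_proj k HG).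
have := limit_orth Ms PM Hs HP PC limit_projP n k HcF HcG.
by move/eqP/negbTE: nk => -> /= ->.
Qed.

Lemma chaos_proj_sum F : L2_functional Z X F ->
  L2_cvg P (fun N w => condexp P sigmaZ F w +
    \sum_(1 <= n < N.+1) chaos_proj n F w) F.
Proof.
move=> HF; have [F2 HcF] := cls_L2_functional HF.
have C2 n : chaos_proj n F \in L2.
  by have [] := cls_L2_functional (chaos_proj_functional n HF).
have [Z2 _ _] := condexpP (sub_sigma_sigmaZ Z) F2.
have sumP N := L2_sum (index_iota 1 N.+1) (p := xpredT) (fun n _ => C2 n).
have S2 N := L2D Z2 (sumP N).1.
apply/(L2_cvg_cls S2 F2).
have := limit_sum Ms PM Hs Hc HP PC M0s QM M0M Am_mono Hms HmH HmP Hm_id Hm0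
  Hm_dense limit_projP HcF.
congr (norm_cvg _ _ _); apply/funext => N.
rewrite (clsD Z2 (sumP N).1) (sumP N).2 (cls_condexp (sub_sigma_sigmaZ Z) F2).
by congr (_ + _); apply: eq_bigr => n _; rewrite (cls_chaos_proj n HF).
Qed.

End chaos_functionals.

Unset Implicit Arguments.

Theorem theorem2p5 (R : realType) (d : measure_display)
    (Omega : measurableType d) (P : probability Omega R)
    (A : countType) (E0 : ptopologicalType) (E : A -> ptopologicalType)
    (E0_polish : polish R E0) (E_polish : forall a : A, polish R (E a))
    (Z : {RV P >-> borel E0}) (X : forall a : A, {RV P >-> borel (E a)})
    (X_indep : cond_independent Z X)
    (Am : nat -> {fset A})
    (Am_incr : forall m : nat, (Am m `<=` Am m.+1)%fset)
    (Am_cover : forall a : A, exists m : nat, a \in Am m) :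
  [/\ (* the limits defining the pi_n exist *)
      (forall (n : nat) (F : Omega -> R), L2_functional Z X F ->
         L2_functional Z X (chaos_proj Z X Am n F) /\
         L2_cvg P (fun m => pi_fin Z X (Am m) n F) (chaos_proj Z X Am n F)),
      (forall F : Omega -> R, L2_functional Z X F ->
         L2_cvg P
           (fun N w => condexp P (sigmaZ Z) F w
                       + \sum_(1 <= n < N.+1) chaos_proj Z X Am n F w)
           F),
      (forall n : nat,
         orthogonal_projector P (L2_functional Z X) (chaos_proj Z X Am n)) &
      (forall n k : nat, n <> k ->
         orthogonal_ranges P (L2_functional Z X)
           (chaos_proj Z X Am n) (chaos_proj Z X Am k))].
Proof.
split.
- by move=> n F HF; exact: (chaos_proj_cvg X_indep Am_incr Am_cover).
- by move=> F HF; exact: (chaos_proj_sum X_indep Am_incr Am_cover).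
- by move=> n; exact: (chaos_proj_projector X_indep Am_incr Am_cover).
- by move=> n k; exact: (chaos_proj_orthogonal X_indep Am_incr Am_cover).
Qed.
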